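(* Let $p>1$, $H>0$, $0<\varphi<\pi/2$, and let $f\in L^1(-1,1)$ satisfy $\|f\|_{L^1(-1,1)}<H(\sin\varphi)^{p-1}$. Then problem (P) possesses at least one weak solution.
   Context: Problem (P) is the boundary value problem $-\frac{d}{dx}\big[(u(x)+H)\,|u'(x)\cos\varphi+\sin\varphi|^{p-2}(u'(x)\cos\varphi+\sin\varphi)\big]=f(x)$ for $x\in(-1,1)$, $u(-1)=u(1)=0$. Convention: $|z|^{p-2}z=0$ at $z=0$. A weak solution to (P) is a function $u\in W_0^{1,p}(-1,1)$ with $u\ge -H$ such that $\int_{-1}^1 (u+H)|u'\cos\varphi+\sin\varphi|^{p-2}(u'\cos\varphi+\sin\varphi)\,v'\,dx=\int_{-1}^1 f v\,dx$ for all $v\in W_0^{1,p}(-1,1)$ (weak derivatives). Functions in $W^{1,p}_0(-1,1)$ are identified with their absolutely continuous representatives on $[-1,1]$. *)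

(* Defs.v *)
From HB Require Import structures.
From mathcomp Require Import all_boot all_order all_algebra.
From mathcomp Require Import all_classical all_reals all_analysis.

Set Implicit Arguments.
Unset Strict Implicit.
Unset Printing Implicit Defensive.

Import Order.TTheory GRing.Theory Num.Theory.
Import numFieldNormedType.Exports.

Local Open Scope classical_set_scope.
Local Open Scope ring_scope.

Section Sobolev.
Variable R : realType.
Implicit Types (p : R) (f g u v : R -> R).

Local Notation mu := (@lebesgue_measure R).

Definition I11 : set R := `]-1, 1[%classic.

(* A function on (-1,1) is a total function R -> R of which only the values on
   the interval matter; the default value of the restriction [_ \_ I11] is 0. *)
Definition Lp_norm p f : \bar R := 'N[mu]_(p%:E)[EFin \o (f \_ I11)]%E.

Definition Lp p f : Prop := f \_ I11 \in Lfun mu p%:E.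

Definition test_function v : Prop :=
  [/\ forall (n : nat) (x : R), derivable (derive1n n v) x 1,
      compact (closure [set x | v x != 0]) &
      closure [set x | v x != 0] `<=` I11].

Definition weak_derivative u u' : Prop :=
  forall v, test_function v ->
    (\int[mu]_(x in I11) (u x * derive1 v x) =
     - \int[mu]_(x in I11) (u' x * v x))%R.

Definition absolutely_continuous_on (a b : R) u : Prop :=
  forall e : R, 0 < e -> exists2 d : R, 0 < d &
    forall (n : nat) (x y : 'I_n -> R),
      (forall i, [/\ a <= x i, x i <= y i & y i <= b]) ->
      trivIset [set: 'I_n] (fun i => `]x i, y i[%classic) ->
      \sum_(i < n) (y i - x i) < d ->
      \sum_(i < n) `|u (y i) - u (x i)| < e.

(* W1p p u u' : u is in W^{1,p}(-1,1) and u' is its weak derivative *)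
Definition W1p p u u' : Prop :=
  [/\ Lp p u, Lp p u' & weak_derivative u u'].

Definition W1p_norm p u u' : \bar R := (Lp_norm p u + Lp_norm p u')%E.

(* W1p0 p u u' : u is the absolutely continuous representative of an element
   of W^{1,p}_0(-1,1), the closure of the test functions in W^{1,p}(-1,1), and
   u' is its weak derivative (determined up to a null set). *)
Definition W1p0 p u u' : Prop :=
  [/\ W1p p u u',
      absolutely_continuous_on (-1) 1 u &
      exists w : nat -> R -> R,
        (forall n, test_function (w n)) /\
        W1p_norm p (fun x : R => u x - w n x) (fun x : R => u' x - derive1 (w n) x)
          @[n --> \oo] --> 0%E].

(* |z|^{p-2} z; the trailing factor gives the value 0 at z = 0 for every p *)
Definition ppow p (z : R) : R := `|z| `^ (p - 2) * z.

Definition weak_solution (p H phi : R) f u : Prop :=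
  exists u' : R -> R,
    [/\ W1p0 p u u',
        forall x : R, -1 <= x <= 1 -> - H <= u x &
        forall v v' : R -> R, W1p0 p v v' ->
          (\int[mu]_(x in I11)
             ((u x + H) * ppow p (u' x * cos phi + sin phi) * v' x) =
           \int[mu]_(x in I11) (f x * v x))%R].

End Sobolev.

(* Main.v *)
(* With w = u + H and F x the integral of f over (-1, x), a function u solves (P)
   weakly as soon as the flux w |u' cos phi + sin phi|^(p-2) (u' cos phi + sin phi)
   equals C - F for some constant C. Where w > 0 and C - F > 0 this is the
   first-order equation
     w' = (((C - F) / w)^(1/(p-1)) - sin phi) / cos phi,
   whose right-hand side decreases in w and vanishes when w (sin phi)^(p-1) = C - F.
   The bound on the L^1 norm of f lets C range over an interval on which C - F
   stays positive, so the solution with w(-1) = H is trapped between two positive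
   constants; the two ends of that interval give w(1) <= H and w(1) >= H, and
   continuous dependence on C yields w(1) = H. The resulting u is C^1 on [-1, 1];
   test functions approximate it because smoothing the kinks of its piecewise
   linear interpolants keeps the derivatives bounded and convergent pointwise.
   The weak identity for (C - F) against v' is Fubini's theorem, since f is only
   integrable. *)
Require Import Defs.
From mathcomp Require Import all_boot all_order all_algebra.
From mathcomp Require Import all_classical all_reals all_analysis.
From mathcomp Require Import measurable_realfun.
From mathcomp Require Import ring lra.
Import Order.TTheory GRing.Theory Num.Theory.
Import numFieldNormedType.Exports.
Local Open Scope classical_set_scope.
Local Open Scope ring_scope.

(** * Smooth functions and the flat function exp(-1/x) *)

Section Smooth.
Variable R : realType.
Implicit Types (u v : R -> R) (n : nat).

(** The power w^(-1/(p-1)) is singular at w = 0, and nothing keeps w away from 0 before the solution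
    is known. The right-hand side is therefore taken with w clamped to an interval [m, M]: this
    field is bounded and globally Lipschitz, Picard iteration converges for it without cutting the
    interval, and the barriers m and M show afterwards that the clamp never acts. They are the
    values of w at which the extreme fluxes H (sin phi)^(p-1) - ||f|| and H (sin phi)^(p-1) + ||f||
    give zero slope. That W^{1,p}_0 is a closure of test functions costs work on both sides.
    Membership of u requires explicit test functions, built here from exp(-1/x). An arbitrary pair
    v, v' is reached through its approximations, from which v is recovered almost everywhere as the
    primitive of v', and this primitive vanishes at 1. Primitives are total functions on the line,
    zero left of -1, so that every function in the iteration is continuous everywhere and only
    differentiability is restricted to x > -1. *)

Fixpoint smooth_upto n v : Prop :=
  if n is m.+1
  then exists2 v' : R -> R, (forall x : R, is_derive x (1 : R) v (v' x)) & smooth_upto m v'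
  else True.

Definition smooth v := forall n, smooth_upto n v.

Lemma smooth_uptoW n v : smooth_upto n.+1 v -> smooth_upto n v.
Proof.
elim: n v => [//|n IHn] v /= [v' dv Sv]; exists v' => //.
exact: IHn.
Qed.

(** Links the inductive notion to the iterated derivatives in [test_function]. With each derivative
    carried as a witness, products and inverses are handled by induction on the order, without
    Leibniz's formula. *)
Lemma smooth_derivable_derive1n v :
  smooth v -> forall n x, derivable (derive1n n v) x 1.
Proof.
move=> Sv n x; have {Sv}: smooth_upto n.+1 v by exact: Sv.
elim: n v => [|n IHn] v; first by case=> v' dv _; exact: ex_derive.
case=> v' dv Sv'; rewrite derive1Sn.
suff -> : derive1 v = v' by exact: IHn.
by apply/funext => y; rewrite derive1E derive_val.
Qed.

Lemma smooth_derivable v : smooth v -> forall x, derivable v x 1.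
Proof. by move=> /smooth_derivable_derive1n /(_ 0). Qed.

Lemma derivable_continuous v : (forall x, derivable v x 1) -> continuous v.
Proof.
by move=> dv x; apply/differentiable_continuous/derivable1_diffP/dv.
Qed.

Lemma smooth_continuous v : smooth v -> continuous v.
Proof. by move=> /smooth_derivable /derivable_continuous. Qed.

Lemma smooth_derive1 v : smooth v -> smooth (derive1 v).
Proof.
move=> Sv n; have /= [v' dv] := Sv n.+1.
suff -> : derive1 v = v' by [].
by apply/funext => y; rewrite derive1E derive_val.
Qed.

Lemma smooth_cst c : smooth (cst c).
Proof.
move=> n; elim: n c => //= n IHn c; exists (cst 0); last exact: IHn.
by move=> x; exact: is_derive_cst.
Qed.

Lemma smooth_uptoD n u v :
  smooth_upto n u -> smooth_upto n v -> smooth_upto n (u \+ v).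
Proof.
elim: n u v => [//|n IHn] u v /= [u' du Su] [v' dv Sv].
exists (u' \+ v'); last exact: IHn.
by move=> x; exact: is_deriveD.
Qed.

Lemma smooth_uptoM n u v :
  smooth_upto n u -> smooth_upto n v -> smooth_upto n (u \* v).
Proof.
elim: n u v => [//|n IHn] u v Su Sv.
have uS := smooth_uptoW _ _ Su; have vS := smooth_uptoW _ _ Sv.
move: Su Sv => /= [u' du Su] [v' dv Sv].
exists ((u \* v') \+ (v \* u')); last by apply: smooth_uptoD; exact: IHn.
by move=> x; exact: is_deriveM.
Qed.

Lemma smoothD u v : smooth u -> smooth v -> smooth (u \+ v).
Proof. by move=> Su Sv n; exact: smooth_uptoD. Qed.

Lemma smoothM u v : smooth u -> smooth v -> smooth (u \* v).
Proof. by move=> Su Sv n; exact: smooth_uptoM. Qed.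

Lemma smoothZ c u : smooth u -> smooth (fun x => c * u x).
Proof. by move=> Su; apply: (smoothM (cst c)) => //; exact: smooth_cst. Qed.

Lemma smooth_sum m (s : 'I_m -> R -> R) :
  (forall i, smooth (s i)) -> smooth (fun x => \sum_(i < m) s i x).
Proof.
move=> Ss; have -> : (fun x => \sum_(i < m) s i x) = \sum_(i < m) s i.
  by apply/funext => x; rewrite fct_sumE.
elim/big_ind : _ => //; first exact: smooth_cst.
by move=> *; exact: smoothD.
Qed.

(** The derivative -v' (1/v)^2 again contains 1/v, one order lower, so the induction is on the order
    with [v] fixed. *)
Lemma smoothV v : (forall x, v x != 0) -> smooth v -> smooth (fun x => (v x)^-1).
Proof.
move=> v0 Sv n; elim: n => [//|n IHn] /=.
have /= [v' dv Sv'] := Sv n.+1.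
exists ((fun x => -1 * v' x) \* ((fun x => (v x)^-1) \* (fun x => (v x)^-1))).
  move=> x; apply: (is_derive_eq (is_deriveV (v0 x) (dv x))).
  by rewrite /= [_ *: _]mulrC expr2 invfM; ring.
by apply: smooth_uptoM (smooth_uptoM _ _ _ IHn IHn);
  apply: smooth_uptoM => //; exact: smooth_cst.
Qed.

Lemma is_derive_affine (a b x : R) : is_derive x (1 : R) (fun y => a * y + b) a.
Proof.
apply: (is_derive_eq (is_deriveD (is_deriveZ a (is_derive_id x (1 : R)))
  (is_derive_cst b x (1 : R)))).
by rewrite addr0 [_ *: _]mulr1.
Qed.

Lemma smooth_affine a b v : smooth v -> smooth (fun x => v (a * x + b)).
Proof.
move=> Sv n; elim: n v Sv => [//|n IHn] v Sv /=.
have dv := smooth_derivable _ Sv; exists (fun x => a * derive1 v (a * x + b)).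
  move=> x; have dax := is_derive_affine a b x.
  have dva : is_derive (a * x + b) 1 v (derive1 v (a * x + b)).
    by rewrite derive1E; exact: derivableP.
  by rewrite mulrC; exact: (@is_derive1_comp R v (fun x => a * x + b)).
apply: (smooth_uptoM _ (cst a)); first exact: smooth_cst.
exact: IHn (smooth_derive1 _ Sv).
Qed.

(** The polynomial factor in 1/x makes the family closed under differentiation: p becomes X^2 (p -
    p'). Smoothness of every member then follows by one induction. *)
Definition flat (p : {poly R}) (x : R) : R :=
  if 0 < x then p.[x^-1] * expR (- x^-1) else 0.

Lemma horner_le_expR (p : {poly R}) :
  exists2 C : R, 0 < C & forall y, 0 <= y -> `|p.[y]| <= C * expR y.
Proof.
exists (1 + \sum_(i < size p) `|p`_i| * i`!%:R) => [|y y0].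
  by rewrite ltr_pwDl// sumr_ge0.
rewrite horner_coef mulrDl mul1r ler_wpDl ?expR_ge0//.
apply: (le_trans (ler_norm_sum _ _ _)); rewrite mulr_suml ler_sum// => i _.
rewrite normrM -mulrA ler_wpM2l// ger0_norm ?exprn_ge0//.
rewrite -ler_pdivrMl ?ltr0n ?fact_gt0// mulrC.
case: (nat_of_ord i) => [|k].
  by rewrite expr0 fact0 divr1 -(expR0 R) ler_expR.
by rewrite (le_trans _ (expR_ge1Dxn k _))// lerDr.
Qed.

Lemma is_derive_flat (p : {poly R}) (x : R) :
  is_derive x (1 : R) (flat p) (flat ('X^2 * (p - p^`())) x).
Proof.
have [x0|x0|->] := ltgtP x 0.
- rewrite {2}/flat ltNge (ltW x0)/=.
  apply: (@near_eq_is_derive R R R (cst 0)).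
  near=> y; rewrite /flat ltNge ltW//=.
  by near: y; exact: lt_nbhsl.
- rewrite {2}/flat x0.
  apply: (@near_eq_is_derive R R R (fun x => p.[x^-1] * expR (- x^-1))).
    by near=> y; rewrite /flat ifT//; near: y; exact: lt_nbhsr.
  have xN0 : x != 0 by rewrite gt_eqF.
  have dV : is_derive x 1 (fun y : R => y^-1) (- x ^- 2).
    apply: (is_derive_eq (is_deriveV xN0 (is_derive_id x (1 : R)))).
    by rewrite [_ *: _]mulr1.
  have dp : is_derive x 1 (fun x => p.[x^-1]) (p^`().[x^-1] * - x ^- 2).
    exact: (@is_derive1_comp R (horner p) (fun x => x^-1) x _ _ (is_derive_poly p _) dV).
  have de : is_derive x 1 (fun x => expR (- x^-1)) (expR (- x^-1) * x ^- 2).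
    have dN : is_derive x 1 (fun x : R => - x^-1) (x ^- 2).
      by rewrite -[x ^- 2]opprK; exact: is_deriveN.
    exact: (@is_derive1_comp R expR (fun x => - x^-1) x _ _ (is_derive_expR _) dN).
  apply: (is_derive_eq (is_deriveM dp de)).
  rewrite !hornerE /= ![_ *: _]mulrC !expr2 invfM; ring.
- rewrite {2}/flat ltxx.
  (* The bound is taken for X^2 p instead of p: it gives a factor h^2, which beats the h^-1 of the
     difference quotient and leaves C h. *)
  have [C C0 Cp] := horner_le_expR ('X^2 * p).
  suff cv : (fun h : R => h^-1 *: (flat p (h *: 1 + 0) - flat p 0)) @ 0^' --> (0 : R).
    by split; [apply/cvg_ex; exists 0|exact/cvg_lim].
  apply/cvgr0Pnorm_le => e e0; near=> h.
  rewrite /flat ltxx subr0 addr0 [h *: 1]mulr1.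
  case: ltP => h0; last by rewrite scaler0 normr0 ltW.
  rewrite [_ *: _]mulrA normrM (ger0_norm (expR_ge0 _)) expRN.
  rewrite ler_pdivrMr ?expR_gt0//.
  have := Cp h^-1; rewrite invr_ge0 (ltW h0) => /(_ isT).
  rewrite hornerM hornerXn expr2 -mulrA normrM (ger0_norm (ltW _)) ?invr_gt0//.
  rewrite ler_pdivrMl// => /le_trans; apply.
  rewrite mulrA ler_wpM2r ?expR_ge0// -ler_pdivlMr//.
  rewrite -[h]ger0_norm ?(ltW h0)//.
  near: h; apply: dnbhs0_le; exact: divr_gt0.
Unshelve. all: by end_near. Qed.

Lemma smooth_flat p : smooth (flat p).
Proof.
move=> n; elim: n p => //= n IHn p; exists (flat ('X^2 * (p - p^`()))) => //.
by move=> x; exact: is_derive_flat.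
Qed.

Definition smooth_step (x : R) : R := flat 1 x / (flat 1 x + flat 1 (1 - x)).

Lemma flat1_ge0 x : 0 <= flat 1 x.
Proof. by rewrite /flat; case: ifP => // _; rewrite hornerE mul1r expR_ge0. Qed.

Lemma flat1_gt0 x : 0 < x -> 0 < flat 1 x.
Proof. by rewrite /flat => ->; rewrite hornerE mul1r expR_gt0. Qed.

Lemma flat_le0 p x : x <= 0 -> flat p x = 0.
Proof. by rewrite /flat leNgt => /negbTE ->. Qed.

Lemma smooth_step_denom x : 0 < flat 1 x + flat 1 (1 - x).
Proof.
have [x0|x0] := leP x 0; last by rewrite ltr_pwDl ?flat1_gt0 ?flat1_ge0.
by rewrite ltr_wpDl ?flat1_ge0// flat1_gt0//; lra.
Qed.

Lemma smooth_smooth_step : smooth smooth_step.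
Proof.
apply: smoothM; first exact: smooth_flat.
apply: smoothV => [x|]; first by rewrite gt_eqF// smooth_step_denom.
apply: smoothD; first exact: smooth_flat.
under [X in smooth X]eq_fun => x do rewrite addrC -mulN1r.
exact/smooth_affine/smooth_flat.
Qed.

Lemma smooth_step_le0 x : x <= 0 -> smooth_step x = 0.
Proof. by move=> x0; rewrite /smooth_step flat_le0// mul0r. Qed.

Lemma smooth_step_ge1 x : 1 <= x -> smooth_step x = 1.
Proof.
move=> x1; rewrite /smooth_step (@flat_le0 _ (1 - x)) ?addr0; last by lra.
by rewrite divff// gt_eqF// flat1_gt0//; lra.
Qed.

End Smooth.

(** * A smooth profile whose integer shifts have derivatives summing to 1 *)

Section Approximation.
Variable R : realType.
Implicit Types (u g v B : R -> R).

Definition ramp (x : R) : R := x * smooth_step R x.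

Lemma smooth_ramp : smooth R ramp.
Proof.
apply: (smoothM _ id); last exact: smooth_smooth_step.
by move=> n; case: n => [//|n]; exists (cst 1) => [x|];
  [exact: is_derive_id|exact: smooth_cst].
Qed.

Lemma derive1_ramp_lt0 x : x < 0 -> derive1 ramp x = 0.
Proof.
move=> x0; suff dr : is_derive x (1 : R) ramp 0 by rewrite derive1E derive_val.
apply: (@near_eq_is_derive R R R (cst 0)); near=> y; rewrite /ramp smooth_step_le0 ?mulr0//.
by apply: ltW; near: y; exact: lt_nbhsl.
Unshelve. all: by end_near. Qed.

Lemma derive1_ramp_gt1 x : 1 < x -> derive1 ramp x = 1.
Proof.
move=> x0; suff dr : is_derive x (1 : R) ramp 1 by rewrite derive1E derive_val.
apply: (@near_eq_is_derive R R R id); near=> y; rewrite /ramp smooth_step_ge1 ?mulr1//.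
by apply: ltW; near: y; exact: lt_nbhsr.
Unshelve. all: by end_near. Qed.

Lemma derive1_ramp_bounded : exists C, forall x, `|derive1 ramp x| <= C.
Proof.
have cr : continuous (fun x => `|derive1 ramp x|).
  move=> x; apply: continuous_comp; last exact: norm_continuous.
  exact/smooth_continuous/smooth_derive1/smooth_ramp.
have [c _ hc] := EVT_max (ler01 : (0 : R) <= 1) (continuous_subspaceT cr).
exists (1 + `|derive1 ramp c|) => x.
have [x0|x0] := ltP x 0; first by rewrite derive1_ramp_lt0// normr0 addr_ge0.
have [x1|x1] := ltP 1 x; first by rewrite derive1_ramp_gt1// normr1 lerDl.
by rewrite ler_wpDl// hc// in_itv/= x0.
Qed.

(** A smoothed unit step of width 2. The last clause says that the integer shifts of B' form a
    partition of unity; B' may take negative values, hence the separate bound [C] on its absolute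
    value. *)
Definition unit_profile B (C : R) := [/\ smooth R B,
  forall y, y <= 0 -> B y = 0,
  forall y, 2 <= y -> B y = 1,
  forall y, `|derive1 B y| <= C &
  (forall y, ~~ (0 <= y <= 2) -> derive1 B y = 0) /\
  forall n (z : R), 1 < z < n%:R -> \sum_(k < n) derive1 B (z - k%:R) = 1].

Lemma exists_unit_profile : exists B C, unit_profile B C.
Proof.
have [C hC] := derive1_ramp_bounded.
have Sr := smooth_ramp.
have Sr1 : smooth R (fun x => ramp (1 * x + -1)) by exact: smooth_affine.
(* Past 2 both ramps are linear and their difference is x - (x - 1) = 1. The affine form of the
   argument is the one that [smooth_affine] produces. *)
pose B x := ramp x + -1 * ramp (1 * x + -1).
have dB y : derive1 B y = derive1 ramp y - derive1 ramp (y - 1).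
  have dr : is_derive y (1 : R) ramp (derive1 ramp y).
    by rewrite derive1E; apply: derivableP; exact: smooth_derivable.
  have dr1 : is_derive y (1 : R) (fun x => ramp (1 * x + -1)) (derive1 ramp (y - 1)).
    rewrite -[derive1 ramp _]mulr1.
    apply: (@is_derive1_comp R ramp (fun x => 1 * x + -1)).
      rewrite mul1r derive1E; apply: derivableP; exact: smooth_derivable.
    exact: is_derive_affine.
  rewrite derive1E; apply: (@derive_val _ _ _ _ _ _ _ _).
  apply: (is_derive_eq (is_deriveD dr (is_deriveZ (-1) dr1))).
  by rewrite scaleN1r.
exists B, (C + C); split.
- by apply: smoothD => //; exact: smoothZ.
- move=> y y0; rewrite /B /ramp !smooth_step_le0 ?mulr0 ?addr0//; lra.
- by move=> y y2; rewrite /B /ramp !smooth_step_ge1 ?mulr1; lra.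
- by move=> y; rewrite dB (le_trans (ler_normB _ _))// lerD.
split=> [y|n z /andP[z1 zn]].
  rewrite dB negb_and -!ltNge => /orP[y0|y2].
    by rewrite !derive1_ramp_lt0 ?subr0//; lra.
  by rewrite !derive1_ramp_gt1 ?subrr//; lra.
under eq_bigr => k _ do rewrite dB -addrA -opprD natr1.
rewrite -(big_mkord xpredT (fun k => derive1 ramp (z - k%:R) - derive1 ramp (z - k.+1%:R))).
under eq_bigr => k _ do rewrite -opprB.
(* What remains is ramp'(z) - ramp'(z - n), equal to 1 - 0 because z > 1 and z - n < 0. *)
rewrite sumrN telescope_sumr// opprB subr0.
by rewrite derive1_ramp_gt1// derive1_ramp_lt0 ?subr0//; lra.
Qed.

Lemma sum_unit_itv n (z : R) :
  \sum_(k < n) ((k%:R <= z < k.+1%:R)%R%:R : R) = (0 <= z < n%:R)%R%:R.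
Proof.
elim: n => [|n IHn]; first by rewrite big_ord0 leNgt andNb.
rewrite big_ord_recr/= {}IHn -natrD; congr _%:R.
have nn : (n%:R : R) < n.+1%:R by rewrite ltr_nat.
have n0 : 0 <= (n%:R : R) by [].
have [zn|zn] := ltP z n%:R; last first.
  by rewrite andbF add0n (le_trans n0 zn).
by rewrite (lt_trans zn nn) addn0.
Qed.

(** At most three integers k satisfy 0 <= z - k <= 2; they are the integer parts of z, z - 1 and z -
    2, the last one for z - k = 2 exactly. *)
Lemma sum_profile_le B C n (z : R) : unit_profile B C ->
  \sum_(k < n) `|derive1 B (z - k%:R)| <= C * 3.
Proof.
move=> [_ _ _ hC [h0 _]].
have C0 : 0 <= C by apply: le_trans (hC 0).
pose I (z : R) (k : nat) : R := (k%:R <= z < k.+1%:R)%R%:R.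
have I1 (y : R) : \sum_(k < n) I y k <= 1.
  by rewrite sum_unit_itv; case: (_ && _).
have bnd k : `|derive1 B (z - k%:R)| <= C * (I z k + I (z - 1) k + I (z - 2) k).
  have [zk|zk] := boolP (0 <= z - k%:R <= 2); last first.
    by rewrite h0// normr0 mulr_ge0// !addr_ge0// /I.
  rewrite (le_trans (hC _))// ler_peMr//.
  have I_ge0 y : 0 <= I y k by rewrite /I; case: (_ && _).
  have I_eq1 y : k%:R <= y -> y < k%:R + 1 -> I y k = 1.
    by move=> ky yk; rewrite /I -natr1 ky yk.
  case/andP: zk => zk1 zk2.
  have [z1|z1] := ltP (z - k%:R) 1.
    by rewrite I_eq1 -?addrA ?lerDl ?addr_ge0//; lra.
  have [z2|z2] := ltP (z - k%:R) 2.
    by rewrite (I_eq1 (z - 1)) 1?addrAC ?lerDr ?addr_ge0//; lra.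
  by rewrite (I_eq1 (z - 2)) ?lerDr ?addr_ge0//; lra.
apply: (@le_trans _ _ (\sum_(k < n) C * (I z k + I (z - 1) k + I (z - 2) k))).
  by apply: ler_sum => k _; exact: bnd.
rewrite -mulr_sumr ler_wpM2l// !big_split/=.
by have := I1 z; have := I1 (z - 1); have := I1 (z - 2); lra.
Qed.

End Approximation.

(** * Smoothed piecewise linear interpolants as test functions *)

Section SmoothApproximation.
Variable R : realType.
Variables (B : R -> R) (C : R) (u g : R -> R) (K : R).
Hypothesis hB : unit_profile R B C.
Hypothesis du : forall x : R, -1 < x < 1 -> is_derive x (1 : R) u (g x).
Hypothesis cu : {within `[-1, 1], continuous u}.
Hypothesis gK : forall x : R, -1 < x < 1 -> `|g x| <= K.
Hypothesis u0 : u (-1) = 0.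
Hypothesis u1 : u 1 = 0.
Variable N : nat.
Hypothesis N0 : (0 < N)%N.

Let nd (k : nat) : R := -1 + 2 * k%:R / N%:R.
Let slope (k : nat) : R := (u (nd k.+1) - u (nd k)) * (N%:R / 2).
(** Sends [-1, 1] onto [-1, N + 2]. The profiles B(pos x - k) with k < N vary only for pos x in
    [0, N + 1], so a margin of one unit is left at each end. *)
Let pos (x : R) : R := (N%:R + 3) / 2 * x + (N%:R + 1) / 2.

(* The smoothed interpolant of [u] at the nodes [nd k], with the graph squeezed
   horizontally so that its support stays inside (-1, 1). *)
Definition smooth_interpolant (x : R) : R :=
  2 / (N%:R + 3) * \sum_(k < N) slope k * B ((N%:R + 3) / 2 * x + ((N%:R + 1) / 2 - k%:R)).

Let Npos : 0 < (N%:R : R). Proof. by rewrite ltr0n. Qed.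

Let nd_lt k : nd k < nd k.+1.
Proof. by rewrite /nd ltrD2l ltr_pM2r ?invr_gt0// ltr_pM2l// ltr_nat. Qed.

Let nd_ge k : -1 <= nd k.
Proof. by rewrite /nd lerDl divr_ge0// ?mulr_ge0. Qed.

Let nd_le k : (k <= N)%N -> nd k <= 1.
Proof.
move=> kN; rewrite /nd -lerBrDl opprK ler_pdivrMr//.
by have : (k%:R : R) <= N%:R; [rewrite ler_nat|lra].
Qed.

Let slopeE k : (k < N)%N ->
  exists2 xi, nd k < xi < nd k.+1 & slope k = g xi.
Proof.
move=> kN; have [||c] := @MVT R u g (nd k) (nd k.+1) (nd_lt k).
- move=> x; rewrite in_itv/= => /andP[x1 x2]; apply: du.
  by rewrite (le_lt_trans (nd_ge _) x1) (lt_le_trans x2 (nd_le _ _)).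
- apply: continuous_subspaceW cu; apply: subset_itvScc.
    by rewrite bnd_simp nd_ge.
  by rewrite bnd_simp nd_le.
rewrite in_itv/= => cI uE; exists c => //.
rewrite /slope uE /nd -natr1; field.
by rewrite gt_eqF.
Qed.

Let slope_le k : (k < N)%N -> `|slope k| <= K.
Proof.
move=> /[dup] kN /slopeE[xi /andP[x1 x2] ->]; apply: gK.
by rewrite (le_lt_trans (nd_ge _) x1) (lt_le_trans x2 (nd_le _ kN)).
Qed.

Lemma smooth_smooth_interpolant : smooth R smooth_interpolant.
Proof.
apply: smoothZ; apply: smooth_sum => k; apply: smoothZ.
by apply: smooth_affine; case: hB.
Qed.

Lemma derive1_smooth_interpolant x : derive1 smooth_interpolant x =
  \sum_(k < N) slope k * derive1 B (pos x - k%:R).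
Proof.
have [SB _ _ _ _] := hB.
have dk (k : 'I_N) : is_derive x (1 : R)
    (fun x => slope k * B ((N%:R + 3) / 2 * x + ((N%:R + 1) / 2 - k%:R)))
    (slope k * (derive1 B (pos x - k%:R) * ((N%:R + 3) / 2))).
  apply: is_deriveZ.
  apply: (@is_derive1_comp R B (fun x => (N%:R + 3) / 2 * x + ((N%:R + 1) / 2 - k%:R))).
    rewrite /pos -addrA derive1E; apply: derivableP; exact: smooth_derivable.
  exact: is_derive_affine.
have ds := is_derive_sum dk.
have -> : smooth_interpolant = 2 / (N%:R + 3) *: \sum_(k < N)
   (fun x => slope k * B ((N%:R + 3) / 2 * x + ((N%:R + 1) / 2 - k%:R))).
  by apply/funext => y; rewrite /smooth_interpolant /= fct_sumE.
have dz := is_deriveZ (2 / (N%:R + 3)) ds.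
rewrite derive1E (@derive_val _ _ _ _ _ _ _ dz) [LHS]mulr_sumr.
apply: eq_bigr => k _; field.
by rewrite gt_eqF// addr_gt0.
Qed.

Lemma smooth_interpolant_eq0 x :
  ~~ (-1 + 2 / (N%:R + 3) <= x <= 1 - 2 / (N%:R + 3)) -> smooth_interpolant x = 0.
Proof.
have [_ B0 B1 _ _] := hB.
have N3 : 0 < (N%:R + 3 : R) by rewrite addr_gt0.
rewrite negb_and -!ltNge => /orP[xl|xr].
  have : (N%:R + 3) * x < (N%:R + 3) * (-1 + 2 / (N%:R + 3)) by rewrite ltr_pM2l.
  rewrite mulrDr mulrCA divff ?gt_eqF// => xl'.
  rewrite /smooth_interpolant big1 ?mulr0// => k _; rewrite B0 ?mulr0//.
  have : 0 <= (k%:R : R) by [].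
  lra.
have : (N%:R + 3) * x > (N%:R + 3) * (1 - 2 / (N%:R + 3)) by rewrite ltr_pM2l.
rewrite mulrBr mulrCA divff ?gt_eqF// => xr'.
rewrite /smooth_interpolant.
under eq_bigr => k _.
  rewrite B1 ?mulr1; last first.
    have : (k.+1%:R : R) <= N%:R by rewrite ler_nat.
    rewrite -natr1; lra.
  over.
(* To the right of the support every profile equals 1 and the slopes telescope to a multiple of u(1)
   - u(-1) = 0. *)
rewrite /slope -mulr_suml -(big_mkord xpredT (fun k => u (nd k.+1) - u (nd k))).
rewrite telescope_sumr// /nd mulr0 mul0r addr0 u0 mulfK ?gt_eqF//.
by rewrite (_ : -1 + 2 = 1) ?u1 ?subrr ?mul0r ?mulr0//; lra.
Qed.

Lemma test_function_smooth_interpolant : test_function smooth_interpolant.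
Proof.
have N3 : 0 < (N%:R + 3 : R) by rewrite addr_gt0.
pose I : set R := `[-1 + 2 / (N%:R + 3), 1 - 2 / (N%:R + 3)]%classic.
have sI : closure [set x | smooth_interpolant x != 0] `<=` I.
  have -> : I = closure I by apply/closure_id; exact: interval_closed.
  apply: closureS => x /= wx; rewrite /I/= in_itv/=.
  by apply: contraNT wx => /smooth_interpolant_eq0 ->.
split.
- exact/smooth_derivable_derive1n/smooth_smooth_interpolant.
- apply: (subclosed_compact _ _ sI); [exact: closed_closure|exact: segment_compact].
- apply: (subset_trans sI) => x; rewrite /I /I11 /= !in_itv/= => /andP[x1 x2].
  have : 0 < 2 / (N%:R + 3 : R) by rewrite divr_gt0.
  by move=> h; apply/andP; split; lra.
Qed.

Lemma derive1_smooth_interpolant_le x : `|derive1 smooth_interpolant x| <= K * (C * 3).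
Proof.
have K0 : 0 <= K by apply: le_trans (gK 0 _) => //; lra.
rewrite derive1_smooth_interpolant (le_trans (ler_norm_sum _ _ _))//.
apply: (@le_trans _ _ (\sum_(k < N) K * `|derive1 B (pos x - k%:R)|)).
  by apply: ler_sum => k _; rewrite normrM ler_wpM2r// slope_le.
by rewrite -mulr_sumr ler_wpM2l// (sum_profile_le _ _ _ _ _ hB).
Qed.

(** By the partition of unity, the error is a weighted sum of differences g(xi) - g(x), with xi the
    mean value point of cell k. Only cells with 0 <= pos x - k <= 2 count. For them N (xi - x) lies
    between 3x - 3 and 3x + 3, where 3x is the effect of the squeeze; this is where 6 / N comes
    from. *)
Lemma derive1_smooth_interpolant_dist x (e : R) : -1 < x < 1 ->
  (forall y, -1 < y < 1 -> `|y - x| <= 6 / N%:R -> `|g y - g x| <= e) ->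
  0 <= e -> 1 < pos x < N%:R ->
  `|derive1 smooth_interpolant x - g x| <= e * (C * 3).
Proof.
move=> /andP[xl xr] hg e0 posx.
have [_ _ _ _ [dB0 dB1]] := hB.
rewrite derive1_smooth_interpolant [X in _ - X](_ : _ =
  \sum_(k < N) g x * derive1 B (pos x - k%:R)); last first.
  by rewrite -mulr_sumr dB1// mulr1.
rewrite -sumrB.
rewrite (le_trans (ler_norm_sum _ _ _))//.
apply: (@le_trans _ _ (\sum_(k < N) e * `|derive1 B (pos x - k%:R)|)).
  apply: ler_sum => k _ /=; rewrite -mulrBl normrM.
  have [kx|/dB0 ->] := boolP (0 <= pos x - k%:R <= 2); last by rewrite normr0 !mulr0.
  rewrite ler_wpM2r//.
  have [xi /andP[x1 x2] ->] := slopeE _ (ltn_ord k).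
  apply: hg.
    by rewrite (le_lt_trans (nd_ge _) x1) (lt_le_trans x2 (nd_le _ (ltn_ord k))).
  rewrite ler_pdivlMr// -[X in _ * X](gtr0_norm Npos) -normrM mulrBl ler_norml.
  have x1' : -1 * N%:R + 2 * k%:R < xi * N%:R.
    by rewrite (_ : _ + _ = nd k * N%:R) ?ltr_pM2r// /nd; field; rewrite gt_eqF.
  have x2' : xi * N%:R < -1 * N%:R + 2 * (k%:R + 1).
    by rewrite natr1 (_ : _ + _ = nd k.+1 * N%:R) ?ltr_pM2r// /nd; field; rewrite gt_eqF.
  move: posx kx; rewrite /pos => /andP[p1 p2] /andP[k1 k2].
  by apply/andP; split; lra.
by rewrite -mulr_sumr ler_wpM2l// (sum_profile_le _ _ _ _ _ hB).
Qed.

End SmoothApproximation.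

(** A uniform bound together with pointwise convergence of the derivatives is what dominated
    convergence asks for, whatever the exponent p. *)
Lemma exists_smooth_approximation (R : realType) (u g : R -> R) (K : R) :
  (forall x : R, -1 < x < 1 -> is_derive x (1 : R) u (g x)) ->
  {within `[-1, 1], continuous u} ->
  (forall x : R, -1 < x < 1 -> `|g x| <= K) ->
  (forall x : R, -1 < x < 1 -> {for x, continuous g}) ->
  u (-1) = 0 -> u 1 = 0 ->
  exists (w : nat -> R -> R) (M : R),
    [/\ forall n, test_function (w n),
        forall n x, `|derive1 (w n) x| <= M &
        forall x, -1 < x < 1 -> derive1 (w n) x @[n --> \oo] --> g x].
Proof.
move=> du cu gK cg u0 u1; have [B [C hB]] := exists_unit_profile R.
exists (fun n => smooth_interpolant R B u n.+1), (K * (C * 3)); split.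
- move=> n; exact: test_function_smooth_interpolant hB _ _ _ _.
- move=> n x; exact: derive1_smooth_interpolant_le hB du cu gK _ _ _.
move=> x xI; apply/cvgrPdist_le => e e0.
have [_ _ _ hC _] := hB.
have C0 : 0 <= C by apply: le_trans (hC 0).
pose e' := e / (C * 3 + 1).
have e'0 : 0 < e' by rewrite divr_gt0// ltr_wpDl// mulr_ge0.
have /cvgrPdist_le/(_ _ e'0)/nbhs_ballP[d /= d0 hd] := cg _ xI.
case/andP: (xI) => xl xr.
near=> n; rewrite distrC.
have n0 : 0 < (n.+1%:R : R) by [].
apply: (@le_trans _ _ (e' * (C * 3))).
  apply: (derive1_smooth_interpolant_dist _ _ _ _ _ hB du cu) => //.
  - move=> y yI yx; rewrite distrC; apply: hd; rewrite /ball /= distrC.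
    apply: (le_lt_trans yx); rewrite ltr_pdivrMr// mulrC -ltr_pdivrMr//.
    apply: (@le_lt_trans _ _ n%:R); last by rewrite ltr_nat.
    by near: n; exact: nbhs_infty_ger.
  - exact: ltW.
  (* With N = n + 1, the condition 1 < pos x < N reads (x + 1) N > 1 - 3x and (1 - x) N > 1 + 3x;
     both right-hand sides are below 4. *)
  have hl : 4 < (x + 1) * n.+1%:R.
    rewrite mulrC -ltr_pdivrMr; last by lra.
    apply: (@le_lt_trans _ _ n%:R); last by rewrite ltr_nat.
    by near: n; exact: nbhs_infty_ger.
  have hr : 4 < (1 - x) * n.+1%:R.
    rewrite mulrC -ltr_pdivrMr; last by lra.
    apply: (@le_lt_trans _ _ n%:R); last by rewrite ltr_nat.
    by near: n; exact: nbhs_infty_ger.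
  by apply/andP; split; lra.
rewrite /e' mulrAC ler_pdivrMr ?ltr_wpDl ?mulr_ge0//.
by rewrite ler_wpM2l ?(ltW e0)// lerDl.
Unshelve. all: by end_near. Qed.

(** * Picard iteration with a parameter *)

Section Picard.
Variable R : realType.
Notation mu := (@lebesgue_measure R).
Implicit Types x y t : R.

Definition primitive (phi : R -> R) (x : R) : R :=
  \int[mu]_(t in `[-1, x]) phi t.

Lemma continuous_integrable_cc (phi : R -> R) (a b : R) :
  continuous phi -> mu.-integrable `[a, b] (EFin \o phi).
Proof.
move=> cphi; apply: continuous_compact_integrable; first exact: segment_compact.
exact: continuous_subspaceT.
Qed.

Lemma primitive_le (phi : R -> R) x : x <= -1 -> primitive phi x = 0.
Proof.
rewrite /primitive le_eqVlt => /predU1P[->|x1].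
  by rewrite set_itv1 Rintegral_set1.
by rewrite set_itv_ge ?Rintegral_set0// bnd_simp -ltNge.
Qed.

Lemma is_derive_primitive (phi : R -> R) x : continuous phi -> -1 < x ->
  is_derive x (1 : R) (primitive phi) (phi x).
Proof.
move=> cphi x1.
have [] := @continuous_FTC1_closed R phi (-1) x (x + 1) _ _ x1 (cphi x).
- by rewrite ltrDl.
- exact: continuous_integrable_cc.
move=> d1 d2; rewrite -d2 derive1E; exact: derivableP.
Qed.

Lemma lebesgue_measure_oc x y : x <= y -> mu `]x, y] = (y - x)%:E.
Proof.
rewrite lebesgue_measure_itv/= lte_fin.
by rewrite le_eqVlt => /predU1P[->|->]; rewrite ?ltxx ?subrr.
Qed.

Lemma primitive_lipschitz (phi : R -> R) A x y : continuous phi ->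
  (forall t, `|phi t| <= A) -> x <= y ->
  `|primitive phi y - primitive phi x| <= A * (y - x).
Proof.
move=> cphi hA xy; have A0 : 0 <= A := le_trans (normr_ge0 _) (hA 0).
have [y1|y1] := leP y (-1).
  rewrite !primitive_le ?subrr ?normr0 ?mulr_ge0 ?subr_ge0//.
  exact: le_trans xy y1.
wlog x1 : x xy / -1 <= x.
  move=> wl; have [x1|x1] := leP (-1) x; first exact: wl.
  rewrite (primitive_le _ x) ?(ltW x1)// -(primitive_le phi (-1))//.
  by rewrite (le_trans (wl _ (ltW y1) _))// ler_wpM2l//; lra.
have iphi := continuous_integrable_cc phi (-1) y cphi.
rewrite /primitive Rintegral_itvB ?bnd_simp//.
have sub : `]x, y] `<=` `[-1, y] by apply: subset_itvr; rewrite bnd_simp.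
have iphi' : mu.-integrable `]x, y] (EFin \o phi) by apply: integrableS iphi.
rewrite (le_trans (le_normr_Rintegral _ _))//.
apply: (@le_trans _ _ (\int[mu]_(t in `]x, y]) A)).
  apply: le_Rintegral => //.
  - exact: (integrable_norm iphi').
  - apply: integrableS (continuous_integrable_cc (cst A) (-1) y _) => //.
    by move=> z; exact: cvg_cst.
rewrite Rintegral_cst// [X in fine X](_ : _ = (y - x)%:E)//.
exact: lebesgue_measure_oc.
Qed.

Lemma Rintegral_expR_le (L K x : R) : 0 < L -> 0 <= K -> -1 <= x ->
  \int[mu]_(t in `[-1, x]) (2 * L * K * expR (2 * L * (t + 1))) <=
  K * expR (2 * L * (x + 1)).
Proof.
move=> L0 K0; rewrite le_eqVlt => /predU1P[<-|x1].
  by rewrite set_itv1 Rintegral_set1 mulr_ge0// expR_ge0.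
pose F (t : R) : R := K * expR (2 * L * (t + 1)).
pose f (t : R) : R := 2 * L * K * expR (2 * L * (t + 1)).
have dF t : is_derive t (1 : R) F (f t).
  have -> : F = fun t => K * expR (2 * L * t + 2 * L).
    by apply/funext => s; rewrite /F mulrDr mulr1.
  rewrite /f mulrDr mulr1.
  apply: (is_derive_eq (is_deriveZ K (@is_derive1_comp R expR (fun t => 2 * L * t + 2 * L)
    t _ _ (is_derive_expR _) (is_derive_affine R (2 * L) (2 * L) t)))).
  by transitivity (K * (expR (2 * L * t + 2 * L) * (2 * L))); [|ring].
have cf : continuous f.
  have -> : f = fun t => (2 * L) * F t by apply/funext => s; rewrite /f /F !mulrA.
  move=> t; apply: cvgM; first exact: cvg_cst.
  by apply/differentiable_continuous/derivable1_diffP.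
have cF : continuous F.
  by move=> t; apply/differentiable_continuous/derivable1_diffP.
rewrite /Rintegral (@continuous_FTC2 R f F (-1) x x1).
- by rewrite -EFinB /= /F lerBlDr lerDl mulr_ge0// expR_ge0.
- exact: continuous_subspaceT.
- split.
  + by move=> t _; exact: ex_derive.
  + by apply: cvg_at_right_filter; exact: cF.
  + by apply: cvg_at_left_filter; exact: cF.
- by move=> t _; rewrite derive1E derive_val.
Qed.

(** Integrating the weight exp(2L(x + 1)) gains a factor 1/(2L). In the norm with this weight a
    Picard step for an L-Lipschitz field contracts by 1/2, however long the interval is. *)
Lemma primitive_dist (L K : R) (phi psi : R -> R) (x : R) : 0 < L -> 0 <= K ->
  continuous phi -> continuous psi ->
  (forall t, -1 <= t -> `|phi t - psi t| <= 2 * L * K * expR (2 * L * (t + 1))) ->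
  `|primitive phi x - primitive psi x| <= K * expR (2 * L * (x + 1)).
Proof.
move=> L0 K0 cphi cpsi dist.
have [x1|x1] := leP x (-1).
  by rewrite !primitive_le// subrr normr0 mulr_ge0// expR_ge0.
have cd : continuous (phi \- psi) by move=> t; exact: cvgB (cphi t) (cpsi t).
have iphi := continuous_integrable_cc _ (-1) x cphi.
have ipsi := continuous_integrable_cc _ (-1) x cpsi.
have id := continuous_integrable_cc _ (-1) x cd.
rewrite /primitive -RintegralB// (le_trans (le_normr_Rintegral _ id))//.
apply: le_trans (Rintegral_expR_le L K x L0 K0 (ltW x1)).
apply: le_Rintegral => //.
- exact: (integrable_norm id).
- apply: continuous_integrable_cc.
  move=> t; apply: cvgM; first exact: cvg_cst.
  apply: continuous_comp; last exact: continuous_expR.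
  apply: cvgM; first exact: cvg_cst.
  by apply: cvgD; [exact: cvg_id|exact: cvg_cst].
- by move=> t /=; rewrite in_itv/= => /andP[t1 _]; exact: dist.
Qed.

Variables (P : set R) (G : R -> R -> R -> R) (H L A : R).
Hypothesis L0 : 0 < L.
Hypothesis G_bounded : forall c t y, P c -> `|G c t y| <= A.
Hypothesis G_lipschitz : forall c c' t y y', P c -> P c' ->
  `|G c t y - G c' t y'| <= L * (`|c - c'| + `|y - y'|).
Hypothesis G_continuous : forall c (w : R -> R), P c -> continuous w ->
  continuous (fun t => G c t (w t)).

Fixpoint picard (c : R) (n : nat) : R -> R :=
  if n is m.+1
  then fun x => H + primitive (fun t => G c t (picard c m t)) x
  else cst H.

Definition lip (w : R -> R) := forall x y, x <= y -> `|w y - w x| <= A * (y - x).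

Lemma lip_continuous w : 0 <= A -> lip w -> continuous w.
Proof.
move=> A0 lw x; apply/cvgrPdist_le => e e0; near=> y.
have -> : e = (A + 1) * (e / (A + 1)).
  by rewrite mulrC divfK// gt_eqF// ltr_wpDl.
have : `|x - y| <= e / (A + 1).
  near: y; apply: cvgr_dist_le; first exact: cvg_id.
  by rewrite divr_gt0// ltr_wpDl.
move=> xy; apply: (@le_trans _ _ (A * `|x - y|)).
  have [yx|yx] := leP y x; first by rewrite (ger0_norm (_ : 0 <= x - y)) ?subr_ge0// lw.
  by rewrite distrC (distrC x) (ger0_norm (_ : 0 <= y - x)) ?subr_ge0 ?(ltW yx)// lw// ltW.
by rewrite ler_pM// lerDl.
Unshelve. all: by end_near. Qed.

Let A0 c : P c -> 0 <= A.
Proof. by move=> Pc; exact: le_trans (normr_ge0 _) (G_bounded c 0 0 Pc). Qed.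

Lemma lip_addprimitive c w : P c -> continuous w ->
  lip (fun x => H + primitive (fun t => G c t (w t)) x).
Proof.
move=> Pc cw x y xy; rewrite opprD addrACA subrr add0r.
apply: primitive_lipschitz => //; first exact: G_continuous.
by move=> t; exact: G_bounded.
Qed.

Lemma picard_lip c n : P c -> lip (picard c n) /\ continuous (picard c n).
Proof.
move=> Pc; elim: n => [|n [_ cn]] /=.
  split; last exact: cst_continuous.
  by move=> x y xy /=; rewrite subrr normr0 mulr_ge0 ?subr_ge0// (A0 c).
have lp := lip_addprimitive c _ Pc cn.
by split => //; exact: lip_continuous (A0 c Pc) lp.
Qed.

Let weight x := expR (2 * L * (x + 1)).

Let weight_ge1 x : -1 <= x -> 1 <= weight x.
Proof.
move=> x1; rewrite /weight -[leLHS](expR0 R) ler_expR.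
have x1' : 0 <= x + 1 by lra.
by have L0' := ltW L0; rewrite !mulr_ge0.
Qed.

Lemma picard_dist c c' n x : P c -> P c' ->
  `|picard c n x - picard c' n x| <= `|c - c'| * weight x.
Proof.
move=> Pc Pc'; elim: n x => [|n IHn] x /=.
  by rewrite subrr normr0 mulr_ge0// expR_ge0.
have [_ cn] := picard_lip c n Pc; have [_ cn'] := picard_lip c' n Pc'.
rewrite opprD addrACA subrr add0r.
apply: primitive_dist => //; [exact: G_continuous|exact: G_continuous|].
move=> t t1; rewrite (le_trans (G_lipschitz _ _ _ _ _ Pc Pc'))//.
(* The direct effect of the parameter is absorbed into the weight, which is at least 1 right of -1.
   The factor 2 in the exponent pays for both contributions, so the bound does not grow with n. *)
have := IHn t; have : `|c - c'| <= `|c - c'| * weight t.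
  by rewrite ler_peMr// weight_ge1.
rewrite -/(weight t) => h1 h2.
have -> : 2 * L * `|c - c'| * weight t = L * (2 * (`|c - c'| * weight t)) by ring.
by rewrite ler_wpM2l ?(ltW L0)//; lra.
Qed.

Lemma picard_cauchy c n k x : P c ->
  `|picard c (n + k) x - picard c n x| <= A / (2 * L) / 2 ^+ n * weight x.
Proof.
move=> Pc; have A0' := A0 c Pc.
elim: n x => [|n IHn] x.
  rewrite add0n expr0 divr1; case: k => [|k] /=.
    by rewrite subrr normr0 mulr_ge0 ?expR_ge0// divr_ge0// mulr_ge0// ltW.
  have [_ ck] := picard_lip c k Pc.
  (* The constant iterate is read as H plus the primitive of 0, so the same estimate starts the
     induction; A / (2L) is the value for which 2LK equals the bound [A] of the field. *)
  have -> : H + primitive (fun t => G c t (picard c k t)) x - cst H x =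
      primitive (fun t => G c t (picard c k t)) x - primitive (cst 0) x.
    by rewrite /primitive Rintegral_cst// mul0r subr0 /= addrC addKr.
  apply: primitive_dist => //.
  - by rewrite divr_ge0// mulr_ge0// ltW.
  - exact: G_continuous.
  - exact: cst_continuous.
  move=> t t1; rewrite subr0 (le_trans (G_bounded _ _ _ Pc))//.
  rewrite mulrCA divff ?mulr1 ?ler_peMr ?weight_ge1//.
  by rewrite gt_eqF// mulr_gt0.
have [_ cn] := picard_lip c n Pc; have [_ cn'] := picard_lip c (n + k) Pc.
rewrite addSn /= opprD addrACA subrr add0r.
apply: primitive_dist => //.
- by rewrite !divr_ge0// ?exprn_ge0// mulr_ge0// ltW.
- exact: G_continuous.
- exact: G_continuous.
move=> t t1; rewrite (le_trans (G_lipschitz _ _ _ _ _ Pc Pc))//.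
rewrite subrr normr0 add0r -/(weight t).
have -> : 2 * L * (A / (2 * L) / 2 ^+ n.+1) * weight t =
    L * (A / (2 * L) / 2 ^+ n * weight t).
  by rewrite exprS; field; rewrite expf_neq0// gt_eqF.
by rewrite ler_wpM2l ?(ltW L0)//; exact: IHn.
Qed.

Definition picard_limit c x := limn (fun n => picard c n x).

Let rate (x : R) : nat -> R := fun n => A / (2 * L) / 2 ^+ n * weight x.

Let rate_ge0 c x n : P c -> 0 <= rate x n.
Proof.
move=> Pc; rewrite mulr_ge0 ?expR_ge0// !divr_ge0 ?(A0 c Pc) ?exprn_ge0//.
by rewrite mulr_ge0// ltW.
Qed.

Let rate_cvg x : rate x n @[n --> \oo] --> 0.
Proof.
rewrite /rate -[X in _ --> X](mul0r (weight x)).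
apply: cvgM; last exact: cvg_cst.
rewrite -[X in _ --> X](mulr0 (A / (2 * L))).
apply: cvgM; first exact: cvg_cst.
under eq_fun do rewrite -exprVn.
by apply: cvg_expr; rewrite ger0_norm ?invr_ge0// invf_lt1 ?ltr1n.
Qed.

Lemma picard_cvg c x : P c -> picard c n x @[n --> \oo] --> picard_limit c x.
Proof.
move=> Pc; apply/cauchy_cvgP/cauchy_exP => e e0.
have /cvgrPdist_lt/(_ _ e0)[n _ hn] := rate_cvg x.
have hr : rate x n < e.
  by have := hn n (leqnn n); rewrite /= sub0r normrN => /(le_lt_trans (ler_norm _)).
exists (picard c n x); exists n => // m /= nm; rewrite /ball /= distrC.
have := picard_cauchy c n (m - n) x Pc; rewrite subnKC// => /le_lt_trans.
exact.
Qed.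

Lemma picard_limit_rate c n x : P c ->
  `|picard_limit c x - picard c n x| <= rate x n.
Proof.
move=> Pc.
have cv : `|picard c (m + n) x - picard c n x| @[m --> \oo] -->
    `|picard_limit c x - picard c n x|.
  apply: cvg_norm; apply: cvgB; last exact: cvg_cst.
  by rewrite (cvg_shiftn n (fun m => picard c m x)); exact: picard_cvg.
rewrite -(cvg_lim _ cv)//; apply: limr_le; first by apply/cvg_ex; eexists; exact: cv.
by apply: nearW => m; rewrite addnC; exact: picard_cauchy.
Qed.

Lemma picard_limit_lip c : P c -> lip (picard_limit c).
Proof.
move=> Pc x y xy.
have cv : `|picard c m y - picard c m x| @[m --> \oo] -->
    `|picard_limit c y - picard_limit c x|.
  by apply: cvg_norm; apply: cvgB; exact: picard_cvg.
rewrite -(cvg_lim _ cv)//; apply: limr_le; first by apply/cvg_ex; eexists; exact: cv.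
by apply: nearW => m; have [+ _] := picard_lip c m Pc; exact.
Qed.

Lemma picard_limit_continuous c : P c -> continuous (picard_limit c).
Proof. by move=> Pc; exact: lip_continuous (A0 c Pc) (picard_limit_lip c Pc). Qed.

Lemma picard_limit_dist c c' x : P c -> P c' ->
  `|picard_limit c x - picard_limit c' x| <= `|c - c'| * weight x.
Proof.
move=> Pc Pc'.
have cv : `|picard c m x - picard c' m x| @[m --> \oo] -->
    `|picard_limit c x - picard_limit c' x|.
  by apply: cvg_norm; apply: cvgB; exact: picard_cvg.
rewrite -(cvg_lim _ cv)//; apply: limr_le; first by apply/cvg_ex; eexists; exact: cv.
by apply: nearW => m; exact: picard_dist.
Qed.

(** Both sides lie within [rate x n] of iterate n + 1: the left one by the rate of convergence, the
    right one because a Picard step does not enlarge the weighted distance between the limit and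
    iterate n. *)
Lemma picard_limit_fixpoint c x : P c ->
  picard_limit c x = H + primitive (fun t => G c t (picard_limit c t)) x.
Proof.
move=> Pc; set y := RHS.
have cl := picard_limit_continuous c Pc.
have bnd n : `|picard_limit c x - y| <= rate x n + rate x n.
  have := ler_distD (picard c n.+1 x) (picard_limit c x) y.
  move=> /le_trans; apply; apply: lerD.
    apply: (le_trans (picard_limit_rate c n.+1 x Pc)).
    rewrite /rate ler_wpM2r ?expR_ge0// ler_wpM2l//.
      by rewrite divr_ge0 ?(A0 c Pc)// mulr_ge0// ltW.
    by rewrite lef_pV2 ?posrE ?exprn_gt0// exprS ler_peMl ?exprn_ge0// ler1n.
  have [_ cn] := picard_lip c n Pc.
  rewrite /y /= opprD addrACA subrr add0r.
  apply: primitive_dist => //.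
  - by rewrite !divr_ge0 ?(A0 c Pc)// ?exprn_ge0// mulr_ge0// ltW.
  - exact: G_continuous.
  - exact: G_continuous.
  move=> t t1; rewrite (le_trans (G_lipschitz _ _ _ _ _ Pc Pc))//.
  rewrite subrr normr0 add0r distrC -/(weight t).
  have -> : 2 * L * (A / (2 * L) / 2 ^+ n) * weight t = L * (2 * rate t n).
    by rewrite /rate; ring.
  rewrite ler_wpM2l ?(ltW L0)//.
  apply: (le_trans (picard_limit_rate c n t Pc)).
  by rewrite ler_peMl ?ler1n// (rate_ge0 c).
apply/eqP; rewrite -subr_eq0 -normr_le0.
have cv : rate x n + rate x n @[n --> \oo] --> 0 + 0.
  by apply: cvgD; exact: rate_cvg.
rewrite addr0 in cv; rewrite -(cvg_lim _ cv)//.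
by apply: limr_ge; [apply/cvg_ex; exists 0|exact: nearW].
Qed.

End Picard.

(** * Barriers, Lipschitz bounds for powers, truncation *)

Section Barrier.
Variable R : realType.
Implicit Types x y : R.

(** After the last time before x at which w >= a, the function stays below a, so its slope there is
    nonnegative and it cannot have decreased. A weak sign condition strictly below the barrier
    therefore suffices. *)
Lemma barrier_ge (w g : R -> R) (a : R) : continuous w ->
  (forall x, -1 < x -> is_derive x (1 : R) w (g x)) -> a <= w (-1) ->
  (forall x, -1 <= x <= 1 -> w x < a -> 0 <= g x) ->
  forall x, -1 <= x <= 1 -> a <= w x.
Proof.
move=> cw dw aw g0 x /andP[x1 x2]; rewrite leNgt; apply/negP => wx.
pose S : set R := [set y | -1 <= y <= x] `&` [set y | a <= w y].
have S0 : S (-1) by split => //=; rewrite lexx x1.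
have ubS : ubound S x by move=> y [/= /andP[_]].
have supS : S (sup S).
  have : closed S.
    apply: closedI.
      have -> : [set y | -1 <= y <= x] = `[-1, x]%classic.
        by apply/seteqP; split=> y /=; rewrite in_itv.
      exact: interval_closed.
    by apply: (@closed_comp _ _ w [set z | a <= z]) => [y _|]; [exact: cw|exact: closed_ge].
  move=> /closure_id Sc; rewrite {1}Sc; apply: closure_sup; first by exists (-1).
  by exists x.
have {supS} [/= /andP[s1 s2] ws] := supS.
have sx : sup S < x.
  by rewrite lt_neqAle s2 andbT; apply: contraTneq wx => <-; rewrite -leNgt.
have below y : sup S < y -> y <= x -> w y < a.
  move=> sy yx; rewrite ltNge; apply/negP => ay.
  have : y <= sup S.
    by apply: ub_le_sup; [exists x|split => //=; rewrite yx (le_trans s1 (ltW sy))].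
  by rewrite leNgt sy.
have dI y : y \in `](sup S), x[ -> is_derive y (1 : R) w (g y).
  by rewrite in_itv/= => /andP[y1 _]; exact/dw/(le_lt_trans s1 y1).
have [c] := MVT sx dI (continuous_subspaceT cw).
rewrite in_itv/= => /andP[c1 c2] wE.
have gc : 0 <= g c.
  apply: g0; last exact: below (ltW c2).
  by rewrite (le_trans s1 (ltW c1)) (le_trans (ltW c2) x2).
have : 0 <= g c * (x - sup S) by rewrite mulr_ge0// subr_ge0 ltW.
by rewrite -wE subr_ge0 leNgt (lt_le_trans wx ws).
Qed.

Lemma barrier_le (w g : R -> R) (a : R) : continuous w ->
  (forall x, -1 < x -> is_derive x (1 : R) w (g x)) -> w (-1) <= a ->
  (forall x, -1 <= x <= 1 -> a < w x -> g x <= 0) ->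
  forall x, -1 <= x <= 1 -> w x <= a.
Proof.
move=> cw dw aw g0 x xI; rewrite -lerN2.
apply: (@barrier_ge (\- w) (\- g)) xI => /=.
- by move=> y; apply: continuousN; exact: cw.
- by move=> y y1; apply: is_deriveN; exact: dw.
- by rewrite lerN2.
- by move=> y yI; rewrite ltrN2 oppr_ge0; exact: g0.
Qed.

(** The derivative e z^(e - 1) has a monotone power; adding its values at both ends covers the
    increasing and the decreasing case with one constant. *)
Lemma powR_lipschitz (e al be : R) : 0 < al -> exists2 K, 0 <= K &
  forall x y, al <= x <= be -> al <= y <= be -> `|x `^ e - y `^ e| <= K * `|x - y|.
Proof.
move=> al0; exists (`|e| * (al `^ (e - 1) + be `^ (e - 1))).
  by rewrite mulr_ge0// addr_ge0// powR_ge0.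
move=> x y; wlog xy : x y / x <= y.
  move=> wl xI yI; have [xy|/ltW yx] := leP x y; first exact: wl.
  by rewrite distrC (distrC x); exact: wl.
move=> /andP[x1 x2] /andP[y1 y2].
have x0 := lt_le_trans al0 x1; have be0 := lt_le_trans x0 x2.
have [||c] := @MVT_segment R (fun z : R => z `^ e) (fun z : R => e * z `^ (e - 1)) x y xy.
- move=> z; rewrite in_itv/= => /andP[z1 _].
  exact/is_derive1_powR/(lt_trans x0).
- apply: derivable_within_continuous => z; rewrite in_itv/= => /andP[z1 _].
  by apply: derivable_powR; rewrite in_itv/= andbT (lt_le_trans x0).
rewrite in_itv/= => /andP[c1 c2] E.
have c0 := lt_le_trans x0 c1.
rewrite distrC E normrM (distrC x) ler_wpM2r// normrM ler_wpM2l//.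
rewrite ger0_norm ?powR_ge0//.
have [e1|e1] := leP 0 (e - 1).
  rewrite ler_wpDl ?powR_ge0// ge0_ler_powR// ?nnegrE ?(ltW c0) ?(ltW be0)//.
  exact: le_trans c2 y2.
rewrite ler_wpDr ?powR_ge0// -[e - 1]opprB !powRN lef_pV2 ?posrE ?powR_gt0//.
rewrite ge0_ler_powR ?nnegrE ?(ltW al0) ?(ltW c0)//; first by lra.
exact: le_trans x1 c1.
Qed.

Definition clamp (m M y : R) : R := Num.max m (Num.min M y).

Lemma clamp_itv m M y : m <= M -> m <= clamp m M y <= M.
Proof. by move=> mM; rewrite /clamp le_max lexx/= ge_max mM ge_min lexx. Qed.

Lemma clamp_dist m M x y : `|clamp m M x - clamp m M y| <= `|x - y|.
Proof.
rewrite /clamp; have h : `|x - y| = Num.max (x - y) (y - x).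
  have [xy|xy] := leP x y.
    by rewrite ler0_norm ?subr_le0// opprB max_r//; lra.
  by rewrite gtr0_norm ?subr_gt0// max_l//; lra.
rewrite h ler_norml; apply/andP.
by rewrite !minEle !maxEle; split; do ?case: ifPn; rewrite -?ltNge; lra.
Qed.

End Barrier.

(** * The truncated slope field *)

Section Field.
Variables (R : realType) (q s co de A m M : R).
Hypotheses (q0 : 0 < q) (s0 : 0 < s) (co0 : 0 < co) (de0 : 0 < de)
  (m0 : 0 < m) (mM : m <= M).
Implicit Types a y : R.

(** Here [a] is the flux C - F, [y] the value of w, and q will be 1/(p-1). The product form
    separates the two variables for the Lipschitz estimate; [slope_fieldE] restores the quotient. *)
Definition slope_field a y : R := (a `^ q * clamp R m M y `^ (- q) - s) / co.

Let cI y : m <= clamp R m M y <= M. Proof. exact: clamp_itv. Qed.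

Let c0 y : 0 < clamp R m M y.
Proof. by have /andP[h _] := cI y; exact: lt_le_trans m0 h. Qed.

Lemma slope_fieldE a y : de <= a ->
  slope_field a y * co + s = (a / clamp R m M y) `^ q.
Proof.
move=> dea; rewrite /slope_field divfK ?gt_eqF// subrK powRN.
rewrite powRM ?invr_ge0 ?(ltW (c0 y)) ?(ltW (lt_le_trans de0 dea))//.
by rewrite -[in RHS]powR_inv1 ?(ltW (c0 y))// -powRrM mulN1r powRN.
Qed.

(** The number k is (sin phi)^(p-1), the ratio of flux to w at which the slope vanishes; the sign of
    the field is decided by comparing [a] with k times the clamped value. *)
Lemma slope_field_ge0 k a y : de <= a -> 0 <= k -> k `^ q = s ->
  k * clamp R m M y <= a -> 0 <= slope_field a y.
Proof.
move=> dea k0 ks ka; rewrite -(pmulr_lge0 _ co0) -(lerD2r s) add0r slope_fieldE//.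
rewrite -ks ge0_ler_powR ?(ltW q0) ?nnegrE// ?divr_ge0 ?(ltW (c0 y))
  ?(ltW (lt_le_trans de0 dea))//.
by rewrite ler_pdivlMr.
Qed.

Lemma slope_field_le0 k a y : de <= a -> 0 <= k -> k `^ q = s ->
  a <= k * clamp R m M y -> slope_field a y <= 0.
Proof.
move=> dea k0 ks ka; rewrite -(pmulr_lle0 _ co0) -(lerD2r s) add0r slope_fieldE//.
rewrite -ks ge0_ler_powR ?(ltW q0) ?nnegrE// ?divr_ge0 ?(ltW (c0 y))
  ?(ltW (lt_le_trans de0 dea))//.
by rewrite ler_pdivrMr.
Qed.

Lemma slope_field_lipschitz : exists L B : R, [/\ 0 < L,
  forall a y, de <= a <= A -> `|slope_field a y| <= B &
  forall a a' y y', de <= a <= A -> de <= a' <= A ->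
    `|slope_field a y - slope_field a' y'| <= L * (`|a - a'| + `|y - y'|)].
Proof.
have [K K0 hK] := powR_lipschitz R q de A de0.
have [K' K0' hK'] := powR_lipschitz R (- q) m M m0.
have aq a : de <= a <= A -> 0 <= a `^ q <= A `^ q.
  move=> /andP[a1 a2]; have a0 := lt_le_trans de0 a1.
  by rewrite powR_ge0 ge0_ler_powR ?(ltW q0) ?nnegrE ?(ltW a0)// (le_trans (ltW a0)).
have yq y : 0 <= clamp R m M y `^ (- q) <= m `^ (- q).
  rewrite powR_ge0 !powRN lef_pV2 ?posrE ?powR_gt0//.
  rewrite ge0_ler_powR ?(ltW q0) ?nnegrE ?(ltW m0) ?(ltW (c0 y))//.
  by case/andP: (cI y).
(* Product rule for Lipschitz constants; the summand 1 ensures L > 0, as the Picard weight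
   requires. *)
pose L := (K * m `^ (- q) + K' * A `^ q + 1) / co.
exists L, ((A `^ q * m `^ (- q) + s) / co); split.
- by rewrite divr_gt0// ltr_wpDl// addr_ge0// mulr_ge0// powR_ge0.
- move=> a y /aq /andP[a1 a2]; have /andP[y1 y2] := yq y.
  rewrite normrM (gtr0_norm (_ : 0 < co^-1)) ?invr_gt0// ler_pM2r ?invr_gt0//.
  rewrite (le_trans (ler_normB _ _))// (gtr0_norm s0) lerD2r ger0_norm ?mulr_ge0//.
  exact: ler_pM.
move=> a a' y y' aI aI'.
rewrite /slope_field -mulrBl opprB addrA subrK.
rewrite normrM (gtr0_norm (_ : 0 < co^-1)) ?invr_gt0//.
rewrite /L mulrAC ler_pM2r ?invr_gt0//.
set c := clamp R m M y `^ _; set c' := clamp R m M y' `^ _.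
have -> : a `^ q * c - a' `^ q * c' = (a `^ q - a' `^ q) * c + a' `^ q * (c - c').
  by ring.
rewrite (le_trans (ler_normD _ _))// !normrM.
have h1 : `|a `^ q - a' `^ q| * `|c| <= K * `|a - a'| * m `^ (- q).
  apply: ler_pM => //; first exact: hK.
  by have /andP[y1 y2] := yq y; rewrite ger0_norm.
have h2 : `|a' `^ q| * `|c - c'| <= A `^ q * (K' * `|y - y'|).
  have /andP[a1 a2] := aq _ aI'.
  apply: ler_pM => //; first by rewrite ger0_norm.
  by apply: (le_trans (hK' _ _ (cI y) (cI y'))); rewrite ler_wpM2l// clamp_dist.
apply: (le_trans (lerD h1 h2)).
have h3 : 0 <= K * m `^ (- q) * `|y - y'| by rewrite !mulr_ge0// powR_ge0.
have h4 : 0 <= K' * A `^ q * `|a - a'| by rewrite !mulr_ge0// powR_ge0.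
have h5 : 0 <= `|a - a'| + `|y - y'| by rewrite addr_ge0.
lra.
Qed.

End Field.

(** * Continuity of the flux and the shooting argument *)

Section Shooting.
Variable R : realType.
Notation mu := (@lebesgue_measure R).
Implicit Types x y t : R.

Lemma primitive_dist_le (phi : R -> R) x y : mu.-integrable setT (EFin \o phi) ->
  x <= y -> `|primitive R phi y - primitive R phi x| <=
            \int[mu]_(t in `]x, y]) `|phi t|.
Proof.
move=> iphi xy.
have iS (A : set R) : measurable A -> mu.-integrable A (EFin \o phi).
  by move=> mA; apply: integrableS iphi.
have [x1|x1] := leP (-1) x.
  rewrite /primitive Rintegral_itvB ?bnd_simp//; last exact: iS.
  by apply: le_normr_Rintegral => //; exact: iS.
rewrite (primitive_le _ _ x) ?(ltW x1)// subr0.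
have [y1|y1] := leP y (-1).
  by rewrite primitive_le// normr0 Rintegral_ge0.
rewrite /primitive (le_trans (le_normr_Rintegral _ _))//; first exact: iS.
rewrite Rintegral_mkcond [leRHS]Rintegral_mkcond; apply: le_Rintegral => //.
- rewrite -restrict_EFin; apply/(integrable_mkcond _ _).1 => //.
  exact/(integrable_norm (iS _ _)).
- rewrite -restrict_EFin; apply/(integrable_mkcond _ _).1 => //.
  exact/(integrable_norm (iS _ _)).
move=> t _; rewrite !patchE; case: ifPn => [|_]; last first.
  by case: ifP => _; [exact: normr_ge0|exact: lexx].
rewrite inE/= in_itv/= => /andP[t1 t2]; rewrite ifT// inE/= in_itv/= t2 andbT.
exact: lt_le_trans t1.
Qed.

Lemma primitive_continuous (phi : R -> R) :
  mu.-integrable setT (EFin \o phi) -> continuous (primitive R phi).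
Proof.
move=> iphi x; apply/cvgrPdist_lt => e e0.
have [d [d0 hd]] := integral_normr_continuous iphi e0.
have small y z : y <= z -> z - y < d ->
    `|primitive R phi z - primitive R phi y| < e.
  move=> yz zyd; apply: (le_lt_trans (primitive_dist_le _ _ _ iphi yz)).
  by apply: hd => //; rewrite [X in (X < _)%E](lebesgue_measure_oc R y z yz) lte_fin.
near=> y; have : `|x - y| < d by near: y; apply: cvgr_dist_lt.
have [xy|yx] := leP x y.
  by rewrite distrC ger0_norm ?subr_ge0// => h; rewrite distrC small.
by rewrite ger0_norm ?subr_ge0 ?(ltW yx)// => h; rewrite small// ltW.
Unshelve. all: by end_near. Qed.

(** Bounds the oscillation by the norm itself, not by twice the norm as two separate estimates
    would; this matches the strict bound assumed on f. *)
Lemma primitive_dist_total (phi : R -> R) x y :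
  mu.-integrable setT (EFin \o phi) ->
  `|primitive R phi y - primitive R phi x| <= \int[mu]_t `|phi t|.
Proof.
move=> iphi; wlog xy : x y / x <= y.
  move=> wl; have [xy|/ltW yx] := leP x y; first exact: wl.
  by rewrite distrC; exact: wl.
apply: (le_trans (primitive_dist_le _ _ _ iphi xy)).
rewrite Rintegral_mkcond; apply: le_Rintegral => //.
- rewrite -restrict_EFin; apply/(integrable_mkcond _ _).1 => //.
  apply/integrable_norm; exact: integrableS iphi.
- exact: (integrable_norm iphi).
- by move=> t _; rewrite patchE; case: ifP => _; [exact: lexx|exact: normr_ge0].
Qed.

Lemma ppow_powR (p a w : R) : 1 < p -> 0 < a -> 0 < w ->
  w * ppow p ((a / w) `^ (p - 1)^-1) = a.
Proof.
move=> p1 a0 w0; have p10 : 0 < p - 1 by rewrite subr_gt0.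
have aw0 : 0 < a / w by rewrite divr_gt0.
rewrite /ppow ger0_norm ?powR_ge0// mulrC [_ `^ (p - 2) * _]mulrC.
rewrite (_ : p - 2 = p - 1 - 1); last by ring.
rewrite mulr_powRB1 ?powR_ge0// -powRrM mulVf ?gt_eqF// powRr1 ?(ltW aw0)//.
by rewrite divfK// gt_eqF.
Qed.

(* Shooting in the flux constant [C]: the field is monotone in [C - F], so
   [w 1 <= H] at the lower end of the admissible range and [w 1 >= H] at the
   upper end, while the oscillation bound keeps [C - F] positive throughout. *)
Lemma exists_profile (p H s co nf : R) (F : R -> R) :
  1 < p -> 0 < H -> 0 < s -> 0 < co -> continuous F ->
  (forall x y, `|F y - F x| <= nf) -> nf < H * s `^ (p - 1) ->
  exists (C B : R) (w g : R -> R),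
    [/\ continuous w, continuous g,
        forall x y, x <= y -> `|w y - w x| <= B * (y - x),
        forall x, `|g x| <= B &
        [/\ forall x, -1 < x -> is_derive x (1 : R) w (g x),
            w (-1) = H, w 1 = H,
            forall x, -1 <= x <= 1 -> 0 < w x &
            forall x, -1 <= x <= 1 -> w x * ppow p (g x * co + s) = C - F x]].
Proof.
move=> p1 H0 s0 co0 cF hF nfH.
have p10 : 0 < p - 1 by rewrite subr_gt0.
set k := s `^ (p - 1) in nfH *; have k0 : 0 < k by exact: powR_gt0.
pose q := (p - 1)^-1; have q0 : 0 < q by rewrite invr_gt0.
have kq : k `^ q = s by rewrite /k -powRrM divff ?gt_eqF// powRr1// ltW.
have nf0 : 0 <= nf by apply: le_trans (hF 0 0).
(* These are the extreme fluxes; m and M below are the values of w where they give zero slope, and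
   [nf] < H k is what makes m positive. *)
pose de := H * k - nf; pose A := H * k + nf.
have de0 : 0 < de by rewrite subr_gt0.
pose m := de / k; pose M := A / k.
have mH : m <= H by rewrite ler_pdivrMr// gerBl.
have HM : H <= M by rewrite ler_pdivlMr// lerDl.
have m0 : 0 < m by rewrite divr_gt0.
have mM := le_trans mH HM.
have k_clamp y : k * clamp R m M y = Num.max de (Num.min A (k * y)).
  rewrite /clamp maxr_pMr ?(ltW k0)// minr_pMr ?(ltW k0)//.
  by rewrite /m /M [k * (de / k)]mulrC [k * (A / k)]mulrC !divfK ?gt_eqF.
pose rF := range F.
have rF0 : rF !=set0 by exists (F 0), 0.
have ubF : has_ubound rF.
  exists (F 0 + nf) => _ [y _ <-]; have := hF 0 y.
  by rewrite ler_norml => /andP[_]; rewrite lerBlDl.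
have lbF : has_lbound rF.
  exists (F 0 - nf) => _ [y _ <-]; have := hF 0 y.
  by rewrite ler_norml => /andP[+ _]; rewrite lerBrDl.
(* For C = a the flux is at most H k everywhere, for C = b at least H k; hence H is an upper barrier
   in the first case and a lower one in the second. *)
pose a := H * k + inf rF; pose b := H * k + sup rF.
have Fsup x : F x <= sup rF by apply: ub_le_sup => //; exists x.
have Finf x : inf rF <= F x by apply: ge_inf => //; exists x.
have supF x : sup rF <= F x + nf.
  apply: ge_sup => // _ [y _ <-]; have := hF x y.
  by rewrite ler_norml => /andP[_]; rewrite lerBlDl.
have infF x : F x - nf <= inf rF.
  apply: lb_le_inf => // _ [y _ <-]; have := hF x y.
  by rewrite ler_norml => /andP[+ _]; rewrite lerBrDl.
have ab : a <= b by rewrite lerD2l (le_trans (Finf 0)).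
pose P : set R := [set c | a <= c <= b].
have cFI c x : P c -> de <= c - F x <= A.
  move=> /= /andP[c1 c2]; move: c1 c2 (infF x) (supF x); rewrite /a /b /de /A => *.
  by apply/andP; split; lra.
have [L [B [L0 hB hL]]] := slope_field_lipschitz R q s co de A m M q0 s0 co0 de0 m0 mM.
pose G c x y := slope_field R q s co m M (c - F x) y.
have G_bounded c t y : P c -> `|G c t y| <= B by move=> Pc; exact/hB/cFI.
have G_lipschitz c c' t y y' : P c -> P c' ->
    `|G c t y - G c' t y'| <= L * (`|c - c'| + `|y - y'|).
  move=> Pc Pc'; rewrite /G (le_trans (hL _ _ _ _ (cFI _ _ Pc) (cFI _ _ Pc')))//.
  by have -> : c - F t - (c' - F t) = c - c' by ring.
have G_continuous c (w : R -> R) : P c -> continuous w -> continuous (fun t => G c t (w t)).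
  move=> Pc cw t; apply/cvgrPdist_le => e e0.
  have e2 : 0 < e / (2 * L) by rewrite divr_gt0// mulr_gt0.
  near=> t'; rewrite /G (le_trans (hL _ _ _ _ (cFI _ _ Pc) (cFI _ _ Pc)))//.
  have h1 : `|F t - F t'| <= e / (2 * L).
    by near: t'; apply: cvgr_dist_le => //; exact: cF.
  have h2 : `|w t - w t'| <= e / (2 * L).
    by near: t'; apply: cvgr_dist_le => //; exact: cw.
  have -> : c - F t - (c - F t') = F t' - F t by ring.
  rewrite [`|F t' - _|]distrC.
  have -> : e = L * (e / (2 * L) + e / (2 * L)) by field; rewrite gt_eqF.
  by rewrite ler_pM2l// lerD.
pose W := picard_limit R G H.
have cW c : P c -> continuous (W c).
  by move=> Pc; exact: (picard_limit_continuous R P G H L B).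
have WE c x : P c -> W c x = H + primitive R (fun t => G c t (W c t)) x.
  by move=> Pc; exact: (picard_limit_fixpoint R P G H L B).
have dW c x : P c -> -1 < x -> is_derive x (1 : R) (W c) (G c x (W c x)).
  move=> Pc x1; have cG := G_continuous c (W c) Pc (cW c Pc).
  have -> : W c = cst H + primitive R (fun t => G c t (W c t)).
    by apply/funext => y; rewrite WE.
  rewrite -[X in is_derive _ _ _ X]add0r; apply: is_deriveD.
  have := is_derive_primitive R _ x cG x1.
  suff -> : G c x ((cst H + primitive R (fun t => G c t (W c t))) x) = G c x (W c x) by [].
  by congr (G c x); rewrite [RHS]WE.
have W1 c : P c -> W c (-1) = H by move=> Pc; rewrite WE// primitive_le ?addr0.
have Wge c x : P c -> -1 <= x <= 1 -> m <= W c x.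
  move=> Pc; apply: (barrier_ge R (W c) _ m (cW c Pc) (fun y => dW c y Pc)).
    by rewrite W1.
  move=> y yI Wy; apply: (slope_field_ge0 R q s co de m M q0 co0 de0 m0 mM k) => //.
  - by have /andP[] := cFI c y Pc.
  - exact: ltW.
  have /andP[c1 _] := cFI c y Pc.
  (* Below m the clamp returns m, and k m is the smallest flux [de]. *)
  apply: le_trans c1; rewrite k_clamp ge_max lexx/= ge_min.
  by apply/orP; right; move: Wy; rewrite /m ltr_pdivlMr// mulrC => /ltW.
have Wle c x : P c -> -1 <= x <= 1 -> W c x <= M.
  move=> Pc; apply: (barrier_le R (W c) _ M (cW c Pc) (fun y => dW c y Pc)).
    by rewrite W1.
  move=> y yI Wy; apply: (slope_field_le0 R q s co de m M q0 co0 de0 m0 mM k) => //.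
  - by have /andP[] := cFI c y Pc.
  - exact: ltW.
  have /andP[_ c1] := cFI c y Pc.
  apply: (le_trans c1); rewrite k_clamp le_max le_min lexx/=.
  by apply/orP; right; move: Wy; rewrite /M ltr_pdivrMr// mulrC => /ltW.
have I1 : -1 <= (1 : R) <= 1 by apply/andP; split; lra.
have Pa : P a by rewrite /P /= lexx.
have Pb : P b by rewrite /P /= lexx andbT.
have WaH : W a 1 <= H.
  apply: (barrier_le R (W a) _ H (cW a Pa) (fun y => dW a y Pa)) I1; first by rewrite W1.
  move=> y yI Wy; apply: (slope_field_le0 R q s co de m M q0 co0 de0 m0 mM k) => //.
  - by have /andP[] := cFI a y Pa.
  - exact: ltW.
  apply: (@le_trans _ _ (k * H)); first by have := Finf y; rewrite /a; lra.
  by rewrite ler_pM2l// /clamp le_max le_min HM (ltW Wy) orbT.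
have WbH : H <= W b 1.
  apply: (barrier_ge R (W b) _ H (cW b Pb) (fun y => dW b y Pb)) I1; first by rewrite W1.
  move=> y yI Wy; apply: (slope_field_ge0 R q s co de m M q0 co0 de0 m0 mM k) => //.
  - by have /andP[] := cFI b y Pb.
  - exact: ltW.
  apply: (@le_trans _ _ (k * H)); last by have := Fsup y; rewrite /b; lra.
  by rewrite ler_pM2l// /clamp ge_max ge_min mH (ltW Wy) orbT.
have cWc : {within `[a, b], continuous (fun c => W c 1)}.
  (* The Picard limit at 1 is Lipschitz in C with constant exp(4L), the weight at that point. *)
  apply/subspace_continuousP => c cI; apply/cvgrPdist_le => e e0.
  have Pc : P c by move: cI; rewrite /P /= in_itv.
  have E0 : 0 < expR (2 * L * (1 + 1)) := expR_gt0 _.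
  rewrite near_withinE; near=> c' => c'I.
  have Pc' : P c' by move: c'I; rewrite /P /= in_itv.
  have := picard_limit_dist R P G H L B L0 G_bounded G_lipschitz G_continuous c c' 1 Pc Pc'.
  move=> /le_trans; apply; rewrite -ler_pdivlMr//.
  by near: c'; apply: cvgr_dist_le; [exact: cvg_id|exact: divr_gt0].
have HI : Num.min (W a 1) (W b 1) <= H <= Num.max (W a 1) (W b 1).
  by rewrite ge_min WaH le_max WbH orbT.
have [c] := IVT ab cWc HI.
rewrite in_itv/= => Pc Wc1.
exists c, B, (W c), (fun x => G c x (W c x)); split.
- exact: cW.
- exact: (G_continuous c (W c) Pc (cW c Pc)).
- move=> x y xy; exact: (picard_limit_lip R P G H L B).
- by move=> x; exact: G_bounded.
split => //.
- by move=> x; exact: dW.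
- exact: W1.
- by move=> x xI; exact: lt_le_trans m0 (Wge c x Pc xI).
move=> x xI; have /andP[c1 c2] := cFI c x Pc.
rewrite /G (slope_fieldE R q s co de m M co0 de0 m0 mM)//.
(* The barriers place the solution in [m, M], so it solves the equation without truncation and the
   flux identity is exact. *)
have -> : clamp R m M (W c x) = W c x.
  by rewrite /clamp min_r ?Wle// max_r// Wge.
apply: ppow_powR => //; first exact: lt_le_trans de0 c1.
exact: lt_le_trans m0 (Wge c x Pc xI).
Unshelve. all: by end_near. Qed.

End Shooting.

(** * Lebesgue norms on (-1, 1) *)

Section LpInterval.
Variable R : realType.
Notation mu := (@lebesgue_measure R).
Implicit Types (p : R) (h : R -> R).

Lemma measurable_I11 : measurable (@I11 R).
Proof. exact: measurable_itv. Qed.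
Hint Resolve measurable_I11 : core.

Lemma lebesgue_measure_I11 : mu (@I11 R) = 2%:E.
Proof.
rewrite /I11 lebesgue_measure_itv/= lte_fin ifT; last by lra.
by rewrite -EFinB; congr EFin; lra.
Qed.

Lemma integrable_cst_I11 (k : R) : mu.-integrable (@I11 R) (EFin \o cst k).
Proof.
apply: measurable_bounded_integrable => //.
  by rewrite [ltLHS]lebesgue_measure_I11 ltry.
exists `|k|; split; first exact: num_real.
by move=> M kM x _ /=; exact: ltW.
Qed.

Lemma bounded_integrable_I11 h (K : R) : measurable_fun (@I11 R) h ->
  (forall x, @I11 R x -> `|h x| <= K) -> mu.-integrable (@I11 R) (EFin \o h).
Proof.
move=> mh hK; apply: (le_integrable _ _ _ (integrable_cst_I11 K)) => //.
  exact/measurable_EFinP.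
by move=> x xI /=; rewrite lee_fin (le_trans (hK x xI))// ler_norm.
Qed.

Lemma Lp_normE p h : p != 0 ->
  Lp_norm p h = poweR (\int[mu]_(x in @I11 R) (`|h x| `^ p)%:E) p^-1.
Proof.
move=> p0; rewrite /Lp_norm unlock; congr poweR.
rewrite [RHS]integral_mkcond; apply: eq_integral => x _ /=.
rewrite !patchE; case: ifP => // _.
(* Off the interval the restriction has the default value 0, and its power is 0 because p is
   nonzero. *)
by rewrite [X in (`|X| `^ _)%:E](_ : _ = 0)// normr0 powR0.
Qed.

Lemma Lp_norm1E h : Lp_norm 1 h = (\int[mu]_(x in @I11 R) `|h x|%:E)%E.
Proof.
rewrite Lp_normE ?oner_eq0// invr1 poweRe1.
  by apply: eq_integral => x _; rewrite powRr1.
by apply: integral_ge0 => x _; rewrite lee_fin powR_ge0.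
Qed.

Lemma measurable_norm_powR h p : measurable_fun (@I11 R) h ->
  measurable_fun (@I11 R) (fun x => `|h x| `^ p).
Proof.
move=> mh; apply: (@measurableT_comp _ _ _ _ _ _ (@powR R ^~ p)) => //.
exact: measurableT_comp.
Qed.

Lemma bounded_Lp p h (K : R) : 1 <= p -> measurable_fun (@I11 R) h ->
  (forall x, @I11 R x -> `|h x| <= K) -> Lp p h.
Proof.
move=> p1 mh hK; have p0 : 0 < p by apply: lt_le_trans p1.
rewrite /Lp inE; apply/andP; split; rewrite inE/=.
  exact: (measurable_restrictT h measurable_I11).1.
rewrite /finite_norm -/(Lp_norm p h) Lp_normE ?gt_eqF//.
apply: poweR_lty.
have hi : mu.-integrable (@I11 R) (EFin \o (fun x => `|h x| `^ p)).
  apply: (@bounded_integrable_I11 _ (K `^ p)); first exact: measurable_norm_powR.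
  move=> x xI; rewrite ger0_norm ?powR_ge0//.
  by rewrite ge0_ler_powR ?nnegrE ?(ltW p0) ?(le_trans _ (hK x xI))// hK.
have /integrableP[_] := hi; apply: le_lt_trans.
rewrite le_eqVlt; apply/orP; left; apply/eqP; apply: eq_integral => x _.
by rewrite [RHS]gee0_abs// lee_fin powR_ge0.
Qed.

Lemma Lp_measurable p h : Lp p h -> measurable_fun (@I11 R) h.
Proof.
rewrite /Lp inE => /andP[+ _]; rewrite inE/= => mh.
exact: (measurable_restrictT h measurable_I11).2.
Qed.

Lemma Lp_norm_lty p h : Lp p h -> (Lp_norm p h < +oo)%E.
Proof. by rewrite /Lp inE => /andP[_]; rewrite inE. Qed.

(** Hölder's inequality against the constant 1, with q conjugate to p. The added 1 makes [c]
    positive, so that it can be divided by. *)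
Lemma Lp_norm1_le p : 1 < p -> exists2 c : R, 0 < c & forall h,
  measurable_fun (@I11 R) h -> (Lp_norm 1 h <= c%:E * Lp_norm p h)%E.
Proof.
move=> p1; have p0 : 0 < p by apply: lt_trans p1.
pose q := (1 - p^-1)^-1.
have q0 : 0 < q by rewrite invr_gt0 subr_gt0 invf_lt1.
exists (fine (Lp_norm q (cst 1)) + 1).
  by rewrite ltr_wpDl// fine_ge0// /Lp_norm Lnorm_ge0.
move=> h mh.
have fq : Lp_norm q (cst 1) \is a fin_num.
  rewrite ge0_fin_numE ?Lnorm_ge0//; rewrite Lp_normE ?gt_eqF//; apply: poweR_lty.
  under eq_integral do rewrite /= normr1 powR1.
  by rewrite integral_cst// mul1e [ltLHS]lebesgue_measure_I11 ltry.
apply: (@le_trans _ _ (Lp_norm q (cst 1%R) * Lp_norm p h)%E); last first.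
  rewrite lee_wpmul2r ?Lnorm_ge0// -[leLHS]fineK// lee_fin.
  by rewrite lerDl.
rewrite muleC.
have mhI : measurable_fun setT (h \_ (@I11 R)).
  exact: (measurable_restrictT h measurable_I11).1.
have mcI : measurable_fun setT ((cst 1 : R -> R) \_ (@I11 R)).
  by apply: (measurable_restrictT _ measurable_I11).1; exact: measurable_cst.
apply: le_trans (hoelder mu mhI mcI p0 q0 _); last by rewrite /q invrK; ring.
rewrite /Lp_norm le_eqVlt; apply/orP; left; apply/eqP/eq_Lnorm => x /=.
rewrite !patchE; case: ifP => _; first by rewrite mulr1.
by congr EFin; rewrite [RHS]mul0r.
Qed.

Lemma Lp_integrable p h : 1 < p -> Lp p h -> mu.-integrable (@I11 R) (EFin \o h).
Proof.
move=> p1 Lh; have mh := Lp_measurable _ _ Lh.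
have [c c0 /(_ _ mh) hc] := Lp_norm1_le _ p1.
apply/integrableP; split; first exact/measurable_EFinP.
have -> : (\int[mu]_(x in @I11 R) `|(EFin \o h) x| = Lp_norm 1 h)%E.
  by rewrite Lp_norm1E.
apply: (le_lt_trans hc); rewrite lte_mul_pinfty ?lee_fin ?(ltW c0)//.
exact: Lp_norm_lty Lh.
Qed.

Lemma Lp1_integrable h : Lp 1 h -> mu.-integrable setT (EFin \o (h \_ (@I11 R))).
Proof. by move=> /Lfun1_integrable. Qed.

(** Dominated convergence for |h n|^p under the constant K^p, integrable on an interval of finite
    length, followed by a p-th root. *)
Lemma Lp_norm_cvg0 p (h : nat -> R -> R) (K : R) : 0 < p ->
  (forall n, measurable_fun (@I11 R) (h n)) ->
  (forall n x, @I11 R x -> `|h n x| <= K) ->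
  (forall x, @I11 R x -> h n x @[n --> \oo] --> 0) ->
  Lp_norm p (h n) @[n --> \oo] --> 0%E.
Proof.
move=> p0 mh hK h0.
have pN0 : p != 0 by rewrite gt_eqF.
pose k n x : \bar R := (`|h n x| `^ p)%:E.
have kK n x : @I11 R x -> `|h n x| `^ p <= K `^ p.
  move=> xI; have hKx := hK n x xI.
  by rewrite ge0_ler_powR ?nnegrE ?(ltW p0)// (le_trans _ hKx).
have mk n : measurable_fun (@I11 R) (k n).
  by apply/measurable_EFinP; exact: measurable_norm_powR (mh n).
have k0 x : @I11 R x -> k n x @[n --> \oo] --> (cst 0 x : \bar R).
  move=> xI; apply: cvg_EFin; first exact: nearW.
  apply/cvgrPdist_lt => e e0.
  have e' : 0 < e `^ p^-1 by exact: powR_gt0.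
  have /cvgrPdist_lt/(_ _ e') := h0 x xI; apply: filterS => n /=.
  rewrite !sub0r !normrN => hn; rewrite ger0_norm ?powR_ge0//.
  rewrite -[e]powRr1 ?(ltW e0)// -(mulVf pN0) powRrM.
  by rewrite gt0_ltr_powR ?nnegrE ?powR_ge0.
have ae0 : {ae mu, forall x, @I11 R x -> k ^~ x @ \oo --> (cst 0 x : \bar R)}.
  exact: aeW.
have aeK : {ae mu, forall x n, @I11 R x -> (`|k n x| <= (EFin \o cst (powR K p)) x)%E}.
  by apply: aeW => x n xI; rewrite /k gee0_abs ?lee_fin ?powR_ge0// kK.
have m0 : measurable_fun (@I11 R) (cst 0%E : R -> \bar R) by exact: measurable_cst.
have [_ _] := @dominated_convergence _ _ R mu _ measurable_I11 k (cst 0%E) _ mk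
  m0 ae0 (integrable_cst_I11 (K `^ p)) aeK.
rewrite [X in _ --> X -> _](_ : _ = 0%E); last by rewrite integral0.
move=> /fine_cvgP[kfin kcvg].
have normE n : Lp_norm p (h n) = poweR (\int[mu]_(x in @I11 R) k n x) p^-1.
  by rewrite Lp_normE ?gt_eqF.
apply/fine_cvgP; split.
  by apply: filterS kfin => n kn; rewrite normE fin_num_poweR.
apply/cvgrPdist_lt => e e0.
have e' : 0 < e `^ p by exact: powR_gt0.
move/cvgrPdist_lt/(_ _ e') : kcvg; apply: filterS => n /=.
rewrite !sub0r !normrN normE fine_poweR => hn.
have I0 : 0 <= fine (\int[mu]_(x in @I11 R) k n x).
  by apply/fine_ge0/integral_ge0 => x _; rewrite lee_fin powR_ge0.
rewrite ger0_norm in hn; last exact: I0.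
rewrite ger0_norm ?powR_ge0//.
rewrite -[ltRHS]powRr1 ?(ltW e0)// -(mulfV pN0) powRrM.
by rewrite gt0_ltr_powR ?invr_gt0 ?nnegrE ?powR_ge0.
Qed.

End LpInterval.

(** * Integration by parts for integrable functions *)

Section ByParts.
Variable R : realType.
Notation mu := (@lebesgue_measure R).
Implicit Types (a b : R -> R) (x y : R).

Definition supported_I11 a := forall x, ~ @I11 R x -> a x = 0.

Lemma integral_EFin_Rintegral (D : set R) a : measurable D ->
  mu.-integrable D (EFin \o a) ->
  (\int[mu]_(x in D) (a x)%:E)%E = (\int[mu]_(x in D) a x)%:E.
Proof. by move=> mD ia; rewrite /Rintegral fineK// integrable_fin_num. Qed.

(** With the left end moved to -oo the only condition is t <= x, so the Fubini domain below is a
    half-plane rather than a triangle. *)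
Lemma primitiveNy a x : supported_I11 a ->
  primitive R a x = \int[mu]_(t in `]-oo, x]) a t.
Proof.
move=> sa; rewrite /primitive Rintegral_mkcond [RHS]Rintegral_mkcond.
apply: eq_Rintegral => t _; rewrite !patchE !mem_setE !in_itv/=.
case: (leP (-1) t) => //= t1; case: ifP => // _.
by rewrite sa// /I11 /= in_itv/= => /andP[/lt_trans/(_ t1)]; rewrite ltxx.
Qed.

Lemma primitive1 a : supported_I11 a -> primitive R a 1 = \int[mu]_t a t.
Proof.
move=> sa; rewrite primitiveNy// Rintegral_mkcond.
apply: eq_Rintegral => t _; rewrite !patchE !mem_setE !in_itv/=.
case: ifPn => //; rewrite -ltNge => t1.
by rewrite sa// /I11 /= in_itv/= => /andP[_ /(lt_trans t1)]; rewrite ltxx.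
Qed.

Lemma Rintegral_ge_primitive a x : supported_I11 a -> mu.-integrable setT (EFin \o a) ->
  \int[mu]_(t in `[x, +oo[) a t = primitive R a 1 - primitive R a x.
Proof.
move=> sa ia; rewrite primitive1// primitiveNy//.
rewrite -Rintegral_itv_obnd_cbnd; last exact: integrableS ia.
rewrite -(@Rintegral_itvB _ a -oo%O +oo%O x)//; first by rewrite set_itvNyy.
by rewrite set_itvNyy.
Qed.

Lemma primitive_norm_le a x : mu.-integrable setT (EFin \o a) ->
  `|primitive R a x| <= \int[mu]_t `|a t|.
Proof.
move=> ia; have := primitive_dist_total R a (-1) x ia.
by rewrite (primitive_le R a (-1))// subr0.
Qed.

Lemma integrable_mul_primitive a b : mu.-integrable setT (EFin \o a) ->
  mu.-integrable setT (EFin \o b) ->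
  mu.-integrable setT (EFin \o (fun x => a x * primitive R b x)).
Proof.
move=> ia ib; have mpb : measurable_fun setT (primitive R b).
  by apply: continuous_measurable_fun; exact: primitive_continuous.
have /integrableP[/measurable_EFinP ma _] := ia.
have iC := integrableZr measurableT (\int[mu]_t `|b t|) ia.
apply: le_integrable iC => //.
  by apply/measurable_EFinP; exact: measurable_funM.
move=> x _ /=; rewrite lee_fin !normrM ler_wpM2l//.
rewrite (le_trans (primitive_norm_le _ x ib))//.
exact: ler_norm.
Qed.

(** The function b(x) a(y) is integrated over y <= x in both orders. The inner integral is a
    primitive of [a] in one order and, in the other, the total mass of [b] minus its primitive. *)
Lemma primitive_by_parts a b : supported_I11 a -> supported_I11 b ->
  mu.-integrable setT (EFin \o a) -> mu.-integrable setT (EFin \o b) ->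
  \int[mu]_x (b x * primitive R a x) =
  primitive R a 1 * primitive R b 1 - \int[mu]_x (a x * primitive R b x).
Proof.
move=> sa sb ia ib.
have /integrableP[/measurable_EFinP ma fina] := ia.
have /integrableP[/measurable_EFinP mb finb] := ib.
pose f (z : R * R) : R := if z.2 <= z.1 then b z.1 * a z.2 else 0.
have mf : measurable_fun setT f.
  apply: measurable_fun_ifT.
  - by apply: measurable_fun_ler; [exact: measurable_snd|exact: measurable_fst].
  - apply: measurable_funM.
      exact: (measurableT_comp mb measurable_fst).
    exact: (measurableT_comp ma measurable_snd).
  - exact: measurable_cst.
have mEf : measurable_fun setT (EFin \o f) by exact/measurable_EFinP.
have imf : (mu \x mu)%E.-integrable setT (EFin \o f).
  apply: (@integrable12ltyP _ _ _ _ R mu mu (EFin \o f) mEf).2.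
  (* Dropping the condition y <= x bounds the double integral by the product of the two L^1
     norms. *)
  apply: (@le_lt_trans _ _ (\int[mu]_x (`|b x| * \int[mu]_y `|a y|)%:E)%E).
    apply: ge0_le_integral => //.
    - by move=> x _; exact: integral_ge0.
    - apply: (@measurable_fun_fubini_tonelli_F _ _ _ _ R mu (abse \o (EFin \o f))) => //=.
      exact: measurableT_comp.
    - apply/measurable_EFinP; apply: measurable_funM => //.
      exact: measurableT_comp.
    move=> x _; rewrite EFinM -integral_EFin_Rintegral//; last first.
      exact: integrable_norm ia.
    rewrite -ge0_integralZl ?lee_fin//; last first.
      by apply/measurable_EFinP; exact: measurableT_comp.
    apply: ge0_le_integral => //.
    - apply: measurableT_comp => //; exact: (measurableT_comp mEf (pair1_measurable x)).
    - apply/measurable_EFinP; apply: measurable_funM => //.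
      exact: measurableT_comp.
    move=> y _ /=; rewrite /f /= -EFinM lee_fin.
    by case: ifP => _; rewrite ?normrM ?normr0 ?mulr_ge0.
  have /integrableP[_] := integrableZr measurableT (\int[mu]_y `|a y|) (integrable_norm ib).
  apply: le_lt_trans; apply: ge0_le_integral => //.
  - by move=> x _; rewrite lee_fin mulr_ge0 ?Rintegral_ge0.
  - apply/measurable_EFinP; apply: measurable_funM => //.
    exact: measurableT_comp.
  - apply: measurableT_comp => //.
    apply/measurable_EFinP; apply: measurable_funM => //.
    exact: measurableT_comp.
  - by move=> x _ /=; rewrite lee_fin ler_norm.
have section_le (c : R) (h : R -> R) (D : set R) : measurable D ->
    mu.-integrable setT (EFin \o h) ->
    (\int[mu]_y (c * (h \_ D) y)%:E)%E = (c * \int[mu]_(y in D) h y)%:E.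
  move=> mD ih; have ihD : mu.-integrable setT (EFin \o (h \_ D)).
    rewrite -restrict_EFin; apply/(integrable_mkcond _ _).1 => //.
    exact: integrableS ih.
  rewrite integral_EFin_Rintegral//; last exact: (integrableZl measurableT c ihD).
  by rewrite RintegralZl// -Rintegral_mkcond.
have := Fubini imf.
have -> : (fun x => \int[mu]_y (EFin \o f) (x, y))%E =
    (fun x => (b x * primitive R a x)%:E).
  apply/funext => x; rewrite primitiveNy// -section_le//.
  apply: eq_integral => y _; rewrite /f /= patchE mem_setE in_itv/=.
  by case: ifP => // _; rewrite [X in _ * X](_ : _ = 0)// mulr0.
have -> : (fun y => \int[mu]_x (EFin \o f) (x, y))%E =
    (fun y => (a y * (primitive R b 1 - primitive R b y))%:E).
  apply/funext => y; rewrite -Rintegral_ge_primitive// -section_le//.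
  apply: eq_integral => x _; rewrite /f /= patchE mem_setE in_itv/= andbT.
  by case: ifP => _; [rewrite mulrC|rewrite [X in _ * X](_ : _ = 0)// mulr0].
move=> /(congr1 fine) E.
transitivity (\int[mu]_y (a y * (primitive R b 1 - primitive R b y))); first exact: E.
have iab := integrable_mul_primitive _ _ ia ib.
under eq_Rintegral do rewrite mulrBr.
rewrite RintegralB//; last exact: (integrableZr measurableT _ ia).
by rewrite RintegralZr// -primitive1.
Qed.

End ByParts.

(** * Membership in W^{1,p}_0 and the weak identity *)

Section Sobolev.
Variable R : realType.
Notation mu := (@lebesgue_measure R).
Implicit Types (u v g : R -> R) (x y : R).

Lemma primitive_FTC2 u g : continuous u -> continuous g ->
  (forall x, -1 < x < 1 -> is_derive x (1 : R) u (g x)) ->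
  forall x, -1 <= x <= 1 -> primitive R g x = u x - u (-1).
Proof.
move=> cu cg du x /andP[]; rewrite le_eqVlt => /predU1P[<- _|x1 x2].
  by rewrite primitive_le// subrr.
rewrite /primitive /Rintegral (@continuous_FTC2 R g u (-1) x x1)//.
- exact: continuous_subspaceT.
- split.
  + move=> t; rewrite in_itv/= => /andP[t1 t2].
    have tI : -1 < t < 1 by rewrite t1 (lt_le_trans t2 x2).
    by have [] := du t tI.
  + by apply: cvg_at_right_filter; exact: cu.
  + by apply: cvg_at_left_filter; exact: cu.
- move=> t; rewrite in_itv/= => /andP[t1 t2]; rewrite derive1E.
  have tI : -1 < t < 1 by rewrite t1 (lt_le_trans t2 x2).
  by have [] := du t tI.
Qed.

Lemma integrable_restrict_I11 g : mu.-integrable (@I11 R) (EFin \o g) <->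
  mu.-integrable setT (EFin \o (g \_ (@I11 R))).
Proof.
rewrite -restrict_EFin.
exact: (@integrable_mkcond _ _ R mu (@I11 R) (EFin \o g) (measurable_I11 R)).
Qed.

Lemma continuous_integrable_I11 g : continuous g ->
  mu.-integrable (@I11 R) (EFin \o g).
Proof.
move=> cg; apply: integrableS (continuous_integrable_cc R g (-1) 1 cg) => //.
  exact: measurable_I11.
exact: subset_itv_oo_cc.
Qed.

Lemma supported_restrict g : supported_I11 R (g \_ (@I11 R)).
Proof. by move=> x xI; rewrite patchE memNset. Qed.

Lemma primitive_restrict g x : continuous g -> x <= 1 ->
  primitive R (g \_ (@I11 R)) x = primitive R g x.
Proof.
move=> cg x1; have ig : mu.-integrable setT (EFin \o (g \_ (@I11 R))).
  exact/integrable_restrict_I11/continuous_integrable_I11.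
have toOO (h : R -> R) : mu.-integrable `[-1, x] (EFin \o h) ->
    primitive R h x = \int[mu]_(t in `]-1, x[) h t.
  move=> ih; rewrite /primitive -Rintegral_itv_obnd_cbnd; last first.
    by apply: integrableS ih => //; exact: subset_itv_oc_cc.
  by rewrite -Rintegral_itv_bndo_bndc//; apply: integrableS ih => //; exact: subset_itv_oo_cc.
rewrite !toOO; [|exact: continuous_integrable_cc|exact: integrableS ig].
apply: eq_Rintegral => t; rewrite inE/= in_itv/= => /andP[t1 t2].
by rewrite patchE mem_set// /I11 /= in_itv/= t1 (lt_le_trans t2).
Qed.

(** The passage from L^1 convergence of derivatives to uniform convergence of functions, used both
    to approximate the solution and to pass to the limit in test functions. *)
Lemma norm_primitive_le_Lp1 g x : mu.-integrable (@I11 R) (EFin \o g) ->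
  (`|primitive R (g \_ (@I11 R)) x|%:E <= Lp_norm 1 g)%E.
Proof.
move=> /[dup] ig /integrable_restrict_I11 iS.
apply: (@le_trans _ _ (\int[mu]_t `|(g \_ (@I11 R)) t|)%:E).
  by rewrite lee_fin primitive_norm_le.
rewrite -integral_EFin_Rintegral//; last exact: integrable_norm iS.
by rewrite /Lp_norm Lnorm1.
Qed.

Lemma test_function_smooth v : test_function v ->
  [/\ continuous v, continuous (derive1 v),
      forall x, is_derive x (1 : R) v (derive1 v x), v (-1) = 0 & v 1 = 0].
Proof.
move=> [dv _ sv]; have v0 x : ~ @I11 R x -> v x = 0.
  move=> xI; apply: contrapT => /eqP vx; apply/xI/sv.
  exact: subset_closure.
split.
- exact: derivable_continuous (dv 0).
- exact: derivable_continuous (dv 1).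
- by move=> x; rewrite derive1E; apply: derivableP; exact: (dv 0).
- by apply: v0; rewrite /I11 /= in_itv/= ltxx.
- by apply: v0; rewrite /I11 /= in_itv/= ltxx andbF.
Qed.

Lemma primitive_test_function v x : test_function v -> -1 <= x <= 1 ->
  primitive R (derive1 v \_ (@I11 R)) x = v x.
Proof.
move=> /test_function_smooth[cv cv' dv v0 _] xI.
rewrite primitive_restrict//; last by case/andP: xI.
by rewrite (primitive_FTC2 v)// v0 subr0.
Qed.

Lemma Rintegral_I11 g : \int[mu]_(x in @I11 R) g x = \int[mu]_x (g \_ (@I11 R)) x.
Proof. exact: Rintegral_mkcond. Qed.

Lemma I11W x : @I11 R x -> -1 <= x <= 1.
Proof. by rewrite /I11 /= in_itv/= => /andP[/ltW -> /ltW ->]. Qed.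

Lemma Rintegral_restrict_mul (h a b : R -> R) :
  (forall x, @I11 R x -> h x = a x * b x) ->
  \int[mu]_(x in @I11 R) h x = \int[mu]_x ((a \_ (@I11 R)) x * b x).
Proof.
move=> hE; rewrite Rintegral_I11; apply: eq_Rintegral => x _.
rewrite !patchE; case: ifPn => [|_]; first by rewrite inE => /hE.
by rewrite [X in X * _](_ : _ = 0) ?mul0r.
Qed.

Lemma weak_derivative_C1 u g : continuous u -> continuous g ->
  (forall x, -1 < x < 1 -> is_derive x (1 : R) u (g x)) -> u (-1) = 0 ->
  weak_derivative u g.
Proof.
move=> cu cg du u0 v tv; have [cv cv' dv v0 v1] := test_function_smooth v tv.
pose a := g \_ (@I11 R); pose b := derive1 v \_ (@I11 R).
have ia : mu.-integrable setT (EFin \o a).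
  exact/integrable_restrict_I11/continuous_integrable_I11.
have ib : mu.-integrable setT (EFin \o b).
  exact/integrable_restrict_I11/continuous_integrable_I11.
rewrite (Rintegral_restrict_mul _ (derive1 v) (primitive R a)); last first.
  move=> x xI; rewrite /a primitive_restrict//; last by case/andP: (I11W x xI).
  by rewrite (primitive_FTC2 u)// ?I11W// u0 subr0 mulrC.
rewrite primitive_by_parts//; [|exact: supported_restrict..].
rewrite [primitive R (derive1 v \_ _) 1]primitive_test_function//; last first.
  by rewrite lexx andbT; lra.
rewrite v1 mulr0 sub0r; congr (- _); apply/esym/Rintegral_restrict_mul => //.
by move=> x xI; rewrite primitive_test_function// I11W.
Qed.

Lemma absolutely_continuous_lipschitz u (B : R) :
  (forall x y, x <= y -> `|u y - u x| <= B * (y - x)) -> absolutely_continuous_on (-1) 1 u.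
Proof.
move=> uB e e0; have B0 : 0 <= B.
  by have := uB 0 1 ler01; rewrite subr0 mulr1; exact: le_trans.
exists (e / (B + 1)) => [|n x y xy _ small]; first by rewrite divr_gt0// ltr_wpDl.
apply: (@le_lt_trans _ _ (B * \sum_(i < n) (y i - x i))).
  rewrite mulr_sumr; apply: ler_sum => i _; apply: uB.
  by have [] := xy i.
have s0 : 0 <= \sum_(i < n) (y i - x i).
  by apply: sumr_ge0 => i _; rewrite subr_ge0; have [] := xy i.
move: small; rewrite ltr_pdivlMr ?ltr_wpDl// => /le_lt_trans; apply.
by rewrite mulrDr mulr1 mulrC lerDl.
Qed.

Lemma continuous_measurable_I11 g : continuous g -> measurable_fun (@I11 R) g.
Proof. by move=> cg; apply: measurable_funTS; exact: continuous_measurable_fun. Qed.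

Lemma W1p0_C1 p u g (B : R) : 1 < p -> continuous u -> continuous g ->
  (forall x, -1 < x -> is_derive x (1 : R) u (g x)) ->
  (forall x, `|g x| <= B) ->
  (forall x y, x <= y -> `|u y - u x| <= B * (y - x)) ->
  u (-1) = 0 -> u 1 = 0 -> W1p0 p u g.
Proof.
move=> p1 cu cg du gB uB u0 u1; have p0 : 0 < p by apply: lt_trans p1.
have du' x : -1 < x < 1 -> is_derive x (1 : R) u (g x).
  by case/andP => x1 _; exact: du.
have B0 : 0 <= B by apply: le_trans (gB 0).
(* The factor 2 in the bound is the length of the interval. *)
have bnd (h k : R -> R) (M : R) : continuous k -> 
    (forall t, `|k t| <= M) -> (forall x, @I11 R x -> h x = primitive R k x) ->
    forall x, @I11 R x -> `|h x| <= M * 2.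
  move=> ck kM hk x xI; rewrite hk//; have /andP[x1 x2] := I11W x xI.
  have M0 : 0 <= M by apply: le_trans (kM 0).
  have := primitive_lipschitz R k M (-1) x ck kM x1.
  rewrite (primitive_le R k (-1))// subr0 => /le_trans; apply.
  by rewrite ler_wpM2l//; lra.
have [w [M [tw wM wcvg]]] := exists_smooth_approximation R u g B du'
  (continuous_subspaceT cu) (fun x _ => gB x) (fun x _ => cg x) u0 u1.
have M0 : 0 <= M by apply: le_trans (wM 0%N 0).
split.
- split.
  + apply: (bounded_Lp R p u (B * 2)) (ltW p1) _ _.
      exact: continuous_measurable_I11.
    apply: (bnd u g B) => // x xI.
    by rewrite (primitive_FTC2 u)// ?I11W// u0 subr0.
  + apply: (bounded_Lp R p g B) (ltW p1) _ _ => //.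
    exact: continuous_measurable_I11.
  + exact: weak_derivative_C1.
- exact: absolutely_continuous_lipschitz uB.
exists w; split => //.
pose h n x := g x - derive1 (w n) x; pose k n x := u x - w n x.
have ch n : continuous (h n).
  have [_ cw' _ _ _] := test_function_smooth _ (tw n).
  by move=> x; apply: cvgB; [exact: cg|exact: cw'].
have ck n : continuous (k n).
  have [cw _ _ _ _] := test_function_smooth _ (tw n).
  by move=> x; apply: cvgB; [exact: cu|exact: cw].
have hM n x : `|h n x| <= B + M.
  by rewrite (le_trans (ler_normB _ _))// lerD.
have kE n x : @I11 R x -> k n x = primitive R (h n) x.
  have [cw cw' dw w0 _] := test_function_smooth _ (tw n).
  have dk y : -1 < y < 1 -> is_derive y (1 : R) (k n) (h n y).
    by move=> yI; exact: (is_deriveB (du' y yI) (dw y)).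
  move=> xI; rewrite (primitive_FTC2 _ _ (ck n) (ch n) dk _ (I11W x xI)).
  by rewrite [k n (-1)]/k u0 w0 !subr0.
have h0 q : 0 < q -> Lp_norm q (h n) @[n --> \oo] --> 0%E.
  move=> q0; apply: (Lp_norm_cvg0 R q h (B + M)) => //.
    by move=> n; exact: continuous_measurable_I11.
  move=> x; rewrite /I11 /= in_itv/= => xI.
  by rewrite -[X in _ --> X](subrr (g x)); apply: cvgB; [exact: cvg_cst|exact: wcvg].
(* The error k n is the primitive of the derivative error h n, so it is bounded, and it tends to 0
   pointwise because the L^1 norm of h n does; dominated convergence applies a second time. *)
have k0 : Lp_norm p (k n) @[n --> \oo] --> 0%E.
  apply: (Lp_norm_cvg0 R p k ((B + M) * 2)) => //.
  - by move=> n; exact: continuous_measurable_I11.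
  - by move=> n; apply: (bnd (k n) (h n)) => // x xI; exact: kE.
  move=> x xI; have /fine_cvgP[hfin hcvg] := h0 1 ltr01.
  apply/cvgr0Pnorm_le => e e0; move/cvgr0Pnorm_lt/(_ _ e0) : hcvg => hcvg.
  near=> n; rewrite kE//; have /andP[x1 x2] := I11W x xI.
  rewrite -primitive_restrict//.
  have hn : `|fine (Lp_norm 1 (h n))| < e by near: n.
  have hf : Lp_norm 1 (h n) \is a fin_num by near: n.
  rewrite -lee_fin (le_trans (norm_primitive_le_Lp1 _ _ _))//.
    exact: continuous_integrable_I11.
  by rewrite -(fineK hf) lee_fin (le_trans (ler_norm _))// ltW.
rewrite /W1p_norm -[X in _ --> X]adde0.
by apply: cvgeD => //; exact: h0.
Unshelve. all: by end_near. Qed.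

(** Each approximating test function is the primitive of its derivative and vanishes at 1. These
    primitives converge uniformly to the primitive of v' while the functions converge to v in L^1,
    so the limits agree almost everywhere, which is enough under an integral. *)
Lemma W1p0_primitive p v v' : 1 < p -> W1p0 p v v' ->
  primitive R (v' \_ (@I11 R)) 1 = 0 /\
  {ae mu, forall x, @I11 R x -> v x = primitive R (v' \_ (@I11 R)) x}.
Proof.
move=> p1 [[Lv Lv' _] _ [z [tz zcvg]]].
have iv := Lp_integrable R p v p1 Lv; have iv' := Lp_integrable R p v' p1 Lv'.
pose b := v' \_ (@I11 R).
have ib : mu.-integrable setT (EFin \o b) by exact/integrable_restrict_I11.
have [c c0 hc] := Lp_norm1_le R p p1.
have [mv mv'] : measurable_fun (@I11 R) v /\ measurable_fun (@I11 R) v'.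
  by split; [exact: Lp_measurable Lv|exact: Lp_measurable Lv'].
pose d n x := v x - z n x; pose d' n x := v' x - derive1 (z n) x.
have czn n : continuous (z n) by have [] := test_function_smooth _ (tz n).
have czn' n : continuous (derive1 (z n)) by have [] := test_function_smooth _ (tz n).
have md n : measurable_fun (@I11 R) (d n).
  by apply: measurable_funB => //; exact: continuous_measurable_I11.
have md' n : measurable_fun (@I11 R) (d' n).
  by apply: measurable_funB => //; exact: continuous_measurable_I11.
have id' n : mu.-integrable (@I11 R) (EFin \o d' n).
  have i1 := continuous_integrable_I11 _ (czn' n).
  exact: (@integrableB _ _ R mu (@I11 R) (measurable_I11 R) (EFin \o v')
    (EFin \o derive1 (z n)) iv' i1).
have approx (e : R) : 0 < e -> exists2 n, (Lp_norm 1 (d n) <= e%:E)%E &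
    forall x, -1 <= x <= 1 -> `|primitive R b x - z n x| <= e.
  move=> e0; have ec : 0 < e / c by rewrite divr_gt0.
  have /fine_cvgP[zfin /cvgr0Pnorm_lt/(_ _ ec) zsmall] := zcvg.
  have [n [/= nfin nsmall]] := filter_ex (filterI zfin zsmall).
  have Wle : (Lp_norm p (d n) + Lp_norm p (d' n) <= (e / c)%:E)%E.
    rewrite -[leLHS]fineK// lee_fin ltW//.
    exact: le_lt_trans (ler_norm _) nsmall.
  have small (h : R -> R) : measurable_fun (@I11 R) h ->
      (Lp_norm p h <= (e / c)%:E)%E -> (Lp_norm 1 h <= e%:E)%E.
    move=> mh hle; apply: (le_trans (hc h mh)).
    apply: (@le_trans _ _ (c%:E * (e / c)%:E)%E).
      by rewrite lee_wpmul2l// lee_fin ltW.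
    by rewrite -EFinM mulrC divfK// gt_eqF.
  exists n.
    by apply: small => //; apply: le_trans Wle; rewrite leeDl// /Lp_norm Lnorm_ge0.
  move=> x xI; rewrite -(primitive_test_function _ _ (tz n) xI).
  have izn : mu.-integrable setT (EFin \o (derive1 (z n) \_ (@I11 R))).
    exact/integrable_restrict_I11/continuous_integrable_I11.
  rewrite /primitive -RintegralB//; [|exact: integrableS ib|exact: integrableS izn].
  rewrite (@eq_Rintegral _ _ _ mu _ (d' n \_ (@I11 R))); last first.
    move=> t _; rewrite /b !patchE; case: ifP => // _.
    by rewrite [LHS](subrr (0 : R)).
  rewrite -lee_fin; apply: le_trans (norm_primitive_le_Lp1 (d' n) x (id' n)) _.
  by apply: small => //; apply: le_trans Wle; rewrite leeDr// /Lp_norm Lnorm_ge0.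
split.
  apply/eqP; rewrite -normr_le0; apply/ler_addgt0Pr => e e0; rewrite add0r.
  have [n _ /(_ 1)] := approx e e0.
  have [_ _ _ _ ->] := test_function_smooth _ (tz n).
  by rewrite subr0; apply; rewrite lexx andbT; lra.
have cP : continuous (primitive R b) by exact: primitive_continuous.
have mvP : measurable_fun (@I11 R) (EFin \o (v \- primitive R b)).
  apply/measurable_EFinP; apply: measurable_funB => //.
  exact: continuous_measurable_I11.
have mI := measurable_I11 R.
have /(@ae_eq_integral_abs _ _ R mu (@I11 R) (measurable_I11 R) _ mvP) :
    (\int[mu]_(x in @I11 R) `|(EFin \o (v \- primitive R b)%R) x| = 0)%E.
  apply/eqP; rewrite eq_le integral_ge0// andbT; apply/lee_addgt0Pr => e e0; rewrite add0e.
  (* One third bounds the L^1 distance from v to the test function; the uniform error e / 3 over an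
     interval of length 2 gives the other two. *)
  have e3 : 0 < e / 3 by rewrite divr_gt0.
  have [n dn bn] := approx _ e3.
  apply: (@le_trans _ _ (\int[mu]_(x in @I11 R) (`|d n x| + e / 3)%R%:E)%E).
    apply: ge0_le_integral => //.
    - exact: (measurableT_comp (@abse_measurable R _) mvP).
    - apply/measurable_EFinP; apply: measurable_funD => //.
      exact: (measurableT_comp (@normr_measurable R setT) (md n)).
    move=> x xI /=; rewrite lee_fin.
    have := bn x (I11W x xI); rewrite distrC => h.
    by rewrite (le_trans (ler_distD (z n x) _ _))// lerD2l.
  under eq_integral do rewrite EFinD.
  rewrite ge0_integralD//; last 2 first.
  - apply/measurable_EFinP.
    exact: (measurableT_comp (@normr_measurable R setT) (md n)).
  - by move=> x _; rewrite lee_fin ltW.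
  rewrite integral_cst// [X in (_ + _ * X)%E](lebesgue_measure_I11 R) -Lp_norm1E.
  apply: (le_trans (leeD dn (lexx _))).
  by rewrite -EFinM -EFinD lee_fin; lra.
apply: filterS => x /= h xI; apply/eqP; rewrite -subr_eq0; apply/eqP.
by have /= [] := h xI.
Qed.

(** The integral of v' over the interval is 0. This removes the constant C, which shooting may thus
    choose freely, and also the boundary term of the integration by parts. *)
Lemma weak_identity p (C : R) (f v v' : R -> R) : 1 < p -> Lp 1 f -> W1p0 p v v' ->
  \int[mu]_(x in @I11 R) ((C - primitive R (f \_ (@I11 R)) x) * v' x) =
  \int[mu]_(x in @I11 R) (f x * v x).
Proof.
move=> p1 Lf Wv; have [P1 vE] := W1p0_primitive p v v' p1 Wv.
have [[Lv Lv' _] _ _] := Wv.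
pose a := f \_ (@I11 R); pose b := v' \_ (@I11 R).
have ia : mu.-integrable setT (EFin \o a) by exact: Lp1_integrable.
have ib : mu.-integrable setT (EFin \o b).
  apply/integrable_restrict_I11; exact: Lp_integrable p1 Lv'.
rewrite (Rintegral_restrict_mul _ v' (fun x => C - primitive R a x)); last first.
  by move=> x _; rewrite mulrC.
under eq_Rintegral do rewrite mulrBr.
rewrite RintegralB//; [|exact: (integrableZr measurableT C ib)
                       |exact: integrable_mul_primitive].
rewrite (RintegralZr C measurableT ib) -(primitive1 R b (supported_restrict v')).
rewrite [X in X * C]P1 mul0r primitive_by_parts//; [|exact: supported_restrict..].
rewrite [X in _ * X - _]P1 mulr0 !sub0r opprK.
rewrite -(Rintegral_restrict_mul (fun x => f x * primitive R b x))//.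
have mI := measurable_I11 R.
have mf : measurable_fun (@I11 R) f by exact: Lp_measurable Lf.
congr fine; apply: ae_eq_integral => //.
- apply/measurable_EFinP; apply: measurable_funM => //.
  by apply: continuous_measurable_I11; exact: primitive_continuous.
- apply/measurable_EFinP; apply: measurable_funM => //.
  exact: Lp_measurable Lv.
- apply: (@filterS _ _ (ae_filter_ringOfSetsType mu) _ _ _ vE) => x h xI.
  by rewrite h.
Qed.

End Sobolev.

(** * From the profile w to the weak solution u = w - H *)

Theorem theorem3p9 (R : realType) (p H phi : R) (f : R -> R)
  (hp : 1 < p) (hH : 0 < H) (hphi0 : 0 < phi) (hphi1 : phi < pi / 2)
  (hf : Lp 1 f)
  (hfH : (Lp_norm 1 f < (H * sin phi `^ (p - 1))%:E)%E) :
  exists u : R -> R, weak_solution p H phi f u.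
Proof.
have s0 : 0 < sin phi.
  by apply: sin_gt0_pi; rewrite hphi0 (lt_trans hphi1)//; have := pi_gt0 R; lra.
have c0 : 0 < cos phi.
  by apply: cos_gt0_pihalf; rewrite hphi1 andbT; have := pi_gt0 R; lra.
have ia := Lp1_integrable R f hf.
(* The hypothesis on f compares extended reals; its real form, for f extended by 0, is the
   oscillation bound that [exists_profile] takes. *)
have nfE : Lp_norm 1 f =
    (\int[@lebesgue_measure R]_t `|(f \_ (@I11 R)) t|)%:E.
  rewrite -integral_EFin_Rintegral//; last exact: integrable_norm ia.
  by rewrite /Lp_norm Lnorm1.
rewrite nfE lte_fin in hfH.
have [C [B [w [g [cw cg wB gB [dw w0 w1 wpos wE]]]]]] :=
  exists_profile R p H (sin phi) (cos phi) _ _ hp hH s0 c0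
    (primitive_continuous R _ ia)
    (fun x y => primitive_dist_total R _ x y ia) hfH.
have W : W1p0 p (fun x => w x - H) g.
  apply: (W1p0_C1 R p _ g B hp) => //.
  - by move=> x; apply: cvgB; [exact: cw|exact: cvg_cst].
  - move=> x x1; rewrite -[g x]subr0.
    exact: (is_deriveB (dw x x1) (is_derive_cst H x (1 : R))).
  - by move=> x y xy; rewrite opprB addrA subrK; exact: wB.
  - by rewrite w0 subrr.
  - by rewrite w1 subrr.
exists (fun x => w x - H), g; split => //.
  by move=> x xI; rewrite lerBrDl subrr ltW// wpos.
move=> v v' Wv; rewrite -(weak_identity R p C f v v' hp hf Wv).
apply: eq_Rintegral => x; rewrite inE => xI.
by rewrite subrK wE// I11W.
Qed.
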